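(* Let $d\ge1$ and $n\ge0$ be integers and let $\phi,\psi_1,\dots,\psi_d$ be kernels of order $n$. (i) If $f\in C^{n}(\mathbb{R}\times\mathbb{R}^{d})$, then $\|K_{n,w}^{\phi,\psi}f-f\|_\infty=o(w^{-n})$ as $w\to\infty$. (ii) Suppose that $f\in C^{n}(\mathbb{R}\times\mathbb{R}^{d})$ and $M_{n+1}(\phi)<\infty$, $M_{n+1}(\psi_i)<\infty$ for $i=1,\dots,d$. Then for every $w>0$ $$\begin{aligned}\|K_{n,w}^{\phi,\psi}f-f\|_\infty\le{}&\frac{2^{n-(d+1)}}{w^{n}}\sum_{l+|\mathbf{j}|=n}\frac{1}{l!\,\mathbf{j}!}\,\omega\Big(\partial^{(l,\mathbf{j})}f,\tfrac1w,\tfrac1w,\dots,\tfrac1w\Big)\big(M_{l+1}(\phi)+2M_l(\phi)+M_1(\phi)+2M_0(\phi)\big)\\&\times\prod_{i=1}^{d}\big(M_{j_i+1}(\psi_i)+2M_{j_i}(\psi_i)+M_1(\psi_i)+2M_0(\psi_i)\big).\end{aligned}$$ (iii) If $f\in C_b^{n+1}(\mathbb{R}\times\mathbb{R}^{d})$ and $M_{n+1}(\phi)<\infty$, $M_{n+1}(\psi_i)<\infty$ for $i=1,\dots,d$, then for every $w>0$ $$\|K_{n,w}^{\phi,\psi}f-f\|_\infty\le\frac{2^{n-d}}{w^{n+1}}\sum_{l+|\mathbf{j}|=n+1}\frac{1}{l!\,\mathbf{j}!}\,\|\partial^{(l,\mathbf{j})}f\|_\infty\,(M_l(\phi)+M_0(\phi))\prod_{i=1}^{d}(M_{j_i}(\psi_i)+M_0(\psi_i)).$$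 Sums run over integers $l\ge0$ and $\mathbf{j}\in\mathbb{Z}_+^d$.
   Context: Notation. For a multi-index $\mathbf{j}\in\mathbb{Z}_+^d$ (non-negative integer entries): $|\mathbf{j}|=j_1+\dots+j_d$, $\mathbf{j}!=\prod_i j_i!$, and $\mathbf{x}^{\mathbf{j}}=\prod_i x_i^{j_i}$ for $\mathbf{x}\in\mathbb{R}^d$; $0^0=1$. Points of $\mathbb{R}\times\mathbb{R}^d$ are written $(x,\mathbf{y})$; $\partial^{(l,\mathbf{j})}f=\frac{\partial^{l+|\mathbf{j}|}f}{\partial x^l\partial y_1^{j_1}\cdots\partial y_d^{j_d}}$; $\|f\|_\infty=\sup|f|$ over $\mathbb{R}\times\mathbb{R}^d$. Function spaces. $C(\mathbb{R}\times\mathbb{R}^d)$ is the space of uniformly continuous bounded real functions. $C^{n}(\mathbb{R}\times\mathbb{R}^d)$ is the space of $n$-times continuously differentiable real functions all of whose partial derivatives of order exactly $n$ belong to $C(\mathbb{R}\times\mathbb{R}^d)$. $C_b^{m}(\mathbb{R}\times\mathbb{R}^d)$ is the space of $m$-times continuously differentiable real functions all of whose partial derivatives of order at most $m$ are bounded and continuous. Modulus of continuity. For $g\in C(\mathbb{R}\times\mathbb{R}^d)$ and $\delta,\gamma_1,\dots,\gamma_d>0$, $$\omega(g,\delta,\gamma_1,\dots,\gamma_d)=\sup\{|g(x,\mathbf{y})-g(t,\mathbf{s})|:\ |x-t|<\delta,\ |y_i-s_i|<\gamma_i,\ i=1,\dots,d\}.$$ Kernels. For $\chi:\mathbb{R}\to\mathbb{R}$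 and $\beta\ge0$ put $M_\beta(\chi)=\sup_{u\in\mathbb{R}}\sum_{k\in\mathbb{Z}}|u-k|^{\beta}|\chi(u-k)|$. The function $\chi$ is a kernel of order $n$ if (i) $\sum_{k\in\mathbb{Z}}\chi(u-k)=1$ for every $u\in\mathbb{R}$; (ii) the series $\sum_{k\in\mathbb{Z}}|u-k|^{n}|\chi(u-k)|$ is uniformly convergent in $u\in\mathbb{R}$ in the sense that it converges for every $u$ and $\lim_{R\to\infty}\sup_{u\in\mathbb{R}}\sum_{k\in\mathbb{Z},\,|u-k|\ge R}|u-k|^{n}|\chi(u-k)|=0$, and $M_\beta(\chi)<\infty$ for all $0\le\beta\le n$. Operator. For $w>0$, $k\in\mathbb{Z}$, $\mathbf{m}\in\mathbb{Z}^d$ let $I_k^w=[\frac{k}{w},\frac{k+1}{w}]$ and $I_{\mathbf{m}}^w=\prod_{i=1}^d[\frac{m_i}{w},\frac{m_i+1}{w}]$. The Hermite-type sampling Kantorovich operator is $$K_{n,w}^{\phi,\psi}f(x,\mathbf{y})=\sum_{k\in\mathbb{Z}}\sum_{\mathbf{m}\in\mathbb{Z}^d}\phi(wx-k)\prod_{i=1}^d\psi_i(wy_i-m_i)\left(\sum_{l+|\mathbf{j}|\le n}\frac{1}{l!\,\mathbf{j}!}\,w^{d+1}\int_{I_k^w}\int_{I_{\mathbf{m}}^w}\frac{\partial^{l+|\mathbf{j}|}f(u,\mathbf{v})}{\partial u^l\partial\mathbf{v}^{\mathbf{j}}}(x-u)^l(\mathbf{y}-\mathbf{v})^{\mathbf{j}}\,d\mathbf{v}\,du\right),$$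 where the inner sum is over integers $l\ge0$ and $\mathbf{j}\in\mathbb{Z}_+^d$. *)

(* Defs.v *)
From mathcomp Require Import all_boot all_order all_algebra.
From mathcomp Require Import all_classical all_reals all_analysis.

Set Implicit Arguments.
Unset Strict Implicit.
Unset Printing Implicit Defensive.

Import Order.TTheory GRing.Theory Num.Theory.
Import numFieldNormedType.Exports.

Local Open Scope classical_set_scope.
Local Open Scope ring_scope.

(* Registers the filter at +oo so that [f =o_+oo g] is available. *)
Canonical pinfty_filter_on (R : numFieldType) : filter_on R :=
  FilterType (pinfty_nbhs R) _.

(* Sum of an unconditionally (= absolutely) convergent real family; it is only
   meaningful when [summable [set: I] (EFin \o a)] holds. *)
Definition usum (R : realType) (I : choiceType) (a : I -> R) : R :=
  fine (esum [set: I] (EFin \o a)^\+ - esum [set: I] (EFin \o a)^\-)%E.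

Section Kernels.
Variable R : realType.
Implicit Types (chi : R -> R) (b u : R) (n : nat).

(* [0 `^ 0 = 1] for [powR]. *)
Definition moment_term chi b u (k : int) : \bar R :=
  ((`|u - k%:~R| `^ b) * `|chi (u - k%:~R)|)%:E.

Definition moment chi b : \bar R :=
  ereal_sup (range (fun u => \esum_(k in [set: int]) moment_term chi b u k)).

Record sampling_kernel n chi : Prop := SamplingKernel {
  kernel_sum1 : forall u, usum (fun k : int => chi (u - k%:~R)) = 1 ;
  kernel_summable : forall u, summable [set: int] (moment_term chi n%:R u) ;
  kernel_tail :
    (fun r : R => ereal_sup (range (fun u =>
       \esum_(k in [set k : int | r <= `|u - k%:~R|]) moment_term chi n%:R u k)))
      @ +oo --> 0%E ;
  kernel_moment : forall b, 0 <= b <= n%:R -> (moment chi b < +oo)%E }.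

End Kernels.

Section Functions.
Variables (R : realType) (d : nat).
Local Notation point := (R * 'rV[R]_d)%type.
Implicit Types (f g : point -> R) (n l : nat) (j : 'I_d -> nat).

(* [None] is the x-axis, [Some i] the y_i-axis. *)
Definition axis (a : option 'I_d) : point :=
  if a is Some i then (0, delta_mx 0 i) else (1, 0).

Definition pderiv1 (a : option 'I_d) f : point -> R := fun p => 'D_(axis a) f p.

(* The differentiations are composed in the displayed order of
   d^(l+|j|) / dx^l dy_1^(j_1) ... dy_d^(j_d), the y_d-derivatives being taken
   first. *)
Definition pderiv l j f : point -> R :=
  iter l (pderiv1 None)
    (foldr (fun i g => iter (j i) (pderiv1 (Some i)) g) f (enum 'I_d)).

Fixpoint cont_diff n f : Prop :=
  continuous f /\
  (if n is m.+1 then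
     (forall a p, derivable f p (axis a)) /\
     (forall a, cont_diff m (pderiv1 a f))
   else True).

Definition BUC g : Prop := unif_continuous g /\ bounded_fun g.

Definition class_C n f : Prop :=
  cont_diff n f /\
  (forall l j, (l + \sum_i j i)%N = n -> BUC (pderiv l j f)).

Definition class_Cb n f : Prop :=
  cont_diff n f /\
  (forall l j, (l + \sum_i j i <= n)%N ->
     continuous (pderiv l j f) /\ bounded_fun (pderiv l j f)).

Definition supnorm g : \bar R := ereal_sup (range (fun p => `|g p|%:E)).

Definition modulus g (delta : R) (gamma : 'I_d -> R) : \bar R :=
  ereal_sup [set z | exists p q : point,
    [/\ `|p.1 - q.1| < delta,
        forall i, `|p.2 0 i - q.2 0 i| < gamma i
      & z = `|g p - g q|%:E]].

Definition mfact l j : R := (l`! * \prod_i (j i)`!)%N%:R.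

Definition set_coord (v : 'rV[R]_d) (i : 'I_d) (t : R) : 'rV[R]_d :=
  \row_k (if k == i then t else v 0 k).

(* Iterated one-dimensional Lebesgue integral of F over the box
   prod_i [a_i, b_i]; by Fubini this is the d-dimensional integral when F is
   continuous.  Every coordinate of the starting vector 0 gets overwritten. *)
Definition box_integral (a b : 'rV[R]_d) (F : 'rV[R]_d -> R) : R :=
  foldr (fun i G v =>
      \int[lebesgue_measure]_(t in `[a 0 i, b 0 i]) G (set_coord v i t))
    F (enum 'I_d) 0.

(* Multi-indices of weight at most n are encoded with entries in 'I_n.+1. *)
Definition kantorovich_coef n (w : R) f (p : point) (k : int) (m : 'rV[int]_d)
    : R :=
  \sum_(l < n.+1) \sum_(j : {ffun 'I_d -> 'I_n.+1} | (l + \sum_i j i <= n)%N)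
    (mfact l (fun i => j i))^-1 * (w ^+ d.+1 *
      \int[lebesgue_measure]_(u in `[k%:~R / w, (k + 1)%:~R / w])
        box_integral (\row_i ((m 0 i)%:~R / w)) (\row_i ((m 0 i + 1)%:~R / w))
          (fun v => pderiv l (fun i => j i) f (u, v) * (p.1 - u) ^+ l *
                    \prod_i (p.2 0 i - v 0 i) ^+ j i)).

Definition kantorovich_term n (w : R) (phi : R -> R) (psi : 'I_d -> R -> R) f
    (p : point) (km : int * 'rV[int]_d) : R :=
  phi (w * p.1 - km.1%:~R) * \prod_i psi i (w * p.2 0 i - (km.2 0 i)%:~R) *
  kantorovich_coef n w f p km.1 km.2.

Definition kantorovich n (w : R) (phi : R -> R) (psi : 'I_d -> R -> R) f
    : point -> R :=
  fun p => usum (kantorovich_term n w phi psi f p).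

Definition kantorovich_converges n (w : R) (phi : R -> R)
    (psi : 'I_d -> R -> R) f : Prop :=
  forall p, summable [set: int * 'rV[int]_d]
              (EFin \o kantorovich_term n w phi psi f p).

End Functions.

(* Main.v *)
Require Import Defs.
From mathcomp Require Import all_boot all_order all_algebra.
From mathcomp Require Import all_classical all_reals all_analysis.
From mathcomp Require Import ring lra.
Set Implicit Arguments.
Unset Strict Implicit.
Unset Printing Implicit Defensive.
Import Order.TTheory GRing.Theory Num.Theory.
Import numFieldNormedType.Exports.
Local Open Scope classical_set_scope.
Local Open Scope ring_scope.

(** The kernels have total mass one, so the error of the operator at [p] is the
    lattice sum of the kernel weights against the errors of the coefficients.
    The coefficient of a cell is the mean, over [q] in the cell, of the Taylor
    polynomial of [f] at [q] evaluated at [p]; hence its distance to [f p] is at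
    most the largest Taylor remainder over the cell ([le_kantorovich_coef]).

    The remainder is obtained one variable at a time in the order in which
    [pderiv] differentiates ([taylor_remainder]). It is controlled by the
    top-order derivatives on the box centred at [q] with vertex [p], against
    the monomials in [p - q].

    Let [s_a] be the distance from [w * p_a] to the lower corner of the cell
    along the axis [a], in units of the mesh. Then [w * |p_a - q_a| <= s_a + 1]
    for every [q] in the cell, so a remainder of order [m] is dominated by
    [w ^- m] times a linear combination, over the multi-indices [alpha] of weight
    [m], of the products over the axes of [(s_a + 1) ^+ alpha_a * rho s_a], where
    [rho] measures the behaviour of the top-order derivatives. Being products over
    the axes, these terms make the lattice sum factor into one-dimensional
    sums, which the moments of the kernels bound ([kantorovich_estimate]). The
    three parts are instances of this estimate.

    - For the bound by moduli of continuity, a function varies between [q] and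
      [z] by at most its modulus times the product of the
      [1 + w * |z_a - q_a|] ([modulus_chain]); hence [rho s = s + 2]. The
      constants follow from [(s + 1) ^+ l <= 2 ^+ l / 2 * (s ^+ l + 1)].
    - For [f] of class [C_b^(n+1)], the expansion is made at order [n + 1], the
      top-order derivatives are bounded by their norms, and [rho s = 1].
    - For the little-o, uniform continuity gives [eps] when all [s_a] are less
      than a large [r]; otherwise a crude bound [C + C] holds. Both cases are
      covered by [eps] times the product of the factors
      [rho s_a = 1 + kap * (r <= s_a)], where [kap = (C + C) / eps]. The uniform
      tail condition on the kernels makes the sums of the [kap]-terms at most
      [1] for [r] large, independently of [w]. *)

(** * Unconditional sums *)

Section Sums.
Variable R : realType.

(** Homogeneity for a finite factor: the inequality that follows from finite
    sums is applied to [c] and then to its inverse. *)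
Lemma esumZl (I : choiceType) (c : R) (a : I -> \bar R) :
  0 <= c -> (forall i, 0 <= a i)%E ->
  (\esum_(i in [set: I]) (c%:E * a i) = c%:E * \esum_(i in [set: I]) a i)%E.
Proof.
have le_esumZl (e : R) (b : I -> \bar R) : 0 <= e -> (forall i, 0 <= b i)%E ->
    (\esum_(i in [set: I]) (e%:E * b i) <= e%:E * \esum_(i in [set: I]) b i)%E.
  move=> e0 b0; apply: ge_ereal_sup => _ [X [finX _] <-].
  rewrite -ge0_mule_fsumr//; apply: lee_pmul => //; first by apply: fsume_ge0.
  by apply: esum_ge; exists X.
move=> c0 a0; apply/eqP; rewrite eq_le le_esumZl//=.
have [->|cn0] := eqVneq c 0.
  by rewrite mul0e; apply: esum_ge0 => i _; rewrite mul0e.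
have cpos : 0 < c by rewrite lt_def cn0.
rewrite -lee_pdivlMl//; apply: le_trans (le_esumZl _ _ _ _); last 2 first.
- by rewrite invr_ge0.
- by move=> i; rewrite mule_ge0.
by apply: le_esum => i _; rewrite muleA -EFinM mulVf// mul1e.
Qed.

(** The real value of a sum, meaningful for summable nonnegative families; it
    turns the manipulation of signed sums into arithmetic of real numbers. *)
Definition nnsum (I : choiceType) (a : I -> R) : R :=
  fine (\esum_(i in [set: I]) (a i)%:E)%E.

Definition abs_summable (I : choiceType) (a : I -> R) :=
  (\esum_(i in [set: I]) `|a i|%:E < +oo)%E.

Section Family.
Variable I : choiceType.
Implicit Types a b : I -> R.

Lemma le_abs_summable a b : (forall i, `|a i| <= b i) ->
  (\esum_(i in [set: I]) (b i)%:E < +oo)%E -> abs_summable a.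
Proof. by move=> ab; apply: le_lt_trans; apply: le_esum => i _; rewrite lee_fin. Qed.

Lemma nnsumE a : (forall i, 0 <= a i) -> abs_summable a ->
  (\esum_(i in [set: I]) (a i)%:E)%E = (nnsum a)%:E.
Proof.
move=> a0 sa; rewrite fineK// ge0_fin_numE; last by apply: esum_ge0 => i _; rewrite lee_fin.
by apply: le_lt_trans sa; apply: le_esum => i _; rewrite lee_fin ler_norm.
Qed.

Lemma nnsum_ge0 a : (forall i, 0 <= a i) -> 0 <= nnsum a.
Proof. by move=> a0; apply: fine_ge0; apply: esum_ge0 => i _; rewrite lee_fin. Qed.

Lemma abs_summableD a b : abs_summable a -> abs_summable b ->
  abs_summable (fun i => a i + b i).
Proof.
move=> sa sb; apply: (@le_abs_summable _ (fun i => `|a i| + `|b i|)).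
  by move=> i; exact: ler_normD.
under eq_esum do rewrite EFinD.
rewrite esumD; [exact: lte_add_pinfty|by move=> i _; rewrite lee_fin..].
Qed.

Lemma abs_summableZ (c : R) a : abs_summable a -> abs_summable (fun i => c * a i).
Proof.
move=> sa; rewrite /abs_summable; under eq_esum do rewrite normrM EFinM.
rewrite esumZl; first exact: lte_mul_pinfty.
  by [].
by move=> i; rewrite lee_fin.
Qed.

Lemma abs_summable_norm a : abs_summable a -> abs_summable (fun i => `|a i|).
Proof. by rewrite /abs_summable => sa; under eq_esum do rewrite normr_id. Qed.

Lemma abs_summableB a b : abs_summable a -> abs_summable b ->
  abs_summable (fun i => a i - b i).
Proof.
move=> sa sb; have := abs_summableD sa (abs_summableZ (-1) sb).
by congr abs_summable; apply/funext => i; rewrite mulN1r.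
Qed.

Lemma nnsumD a b : (forall i, 0 <= a i) -> (forall i, 0 <= b i) ->
  abs_summable a -> abs_summable b ->
  nnsum (fun i => a i + b i) = nnsum a + nnsum b.
Proof.
move=> a0 b0 sa sb; apply: EFin_inj; rewrite -nnsumE; first last.
- exact: abs_summableD.
- by move=> i; rewrite addr_ge0.
under eq_esum do rewrite EFinD.
by rewrite esumD => *; rewrite ?lee_fin// EFinD !nnsumE.
Qed.

Lemma nnsumZ (c : R) a : 0 <= c -> (forall i, 0 <= a i) -> abs_summable a ->
  nnsum (fun i => c * a i) = c * nnsum a.
Proof.
move=> c0 a0 sa; apply: EFin_inj; rewrite -nnsumE; first last.
- exact: abs_summableZ.
- by move=> i; rewrite mulr_ge0.
by under eq_esum do rewrite EFinM; rewrite esumZl// ?nnsumE.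
Qed.

Lemma le_nnsum a b : (forall i, 0 <= a i <= b i) -> abs_summable b ->
  nnsum a <= nnsum b.
Proof.
move=> ab sb; have a0 i : 0 <= a i by case/andP: (ab i).
have b0 i : 0 <= b i by case/andP: (ab i) => /le_trans h /h.
rewrite -lee_fin -!nnsumE//.
  by apply: le_esum => i _; rewrite lee_fin; case/andP: (ab i).
apply: le_abs_summable (sb) => i; rewrite !ger0_norm//; by case/andP: (ab i).
Qed.

Lemma usumB a b : (forall i, 0 <= a i) -> (forall i, 0 <= b i) ->
  abs_summable a -> abs_summable b ->
  usum (fun i => a i - b i) = nnsum a - nnsum b.
Proof.
move=> a0 b0 sa sb; rewrite /usum.
have := @esumB R I setT (EFin \o a) (EFin \o b) sa sb.
move=> /(_ (fun i _ => a0 i) (fun i _ => b0 i)) /= e.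
transitivity (fine (\esum_(i in [set: I]) (a i)%:E - \esum_(i in [set: I]) (b i)%:E)%E).
  by rewrite -e.
by rewrite !nnsumE.
Qed.

(** Writing [a = |a| - (|a| - a)] with both parts nonnegative is what reduces
    signed sums to nonnegative ones. *)
Lemma usumE a : abs_summable a ->
  usum a = nnsum (fun i => `|a i|) - nnsum (fun i => `|a i| - a i).
Proof.
move=> sa; rewrite -usumB//.
- by congr usum; apply/funext => i; rewrite opprB addrC subrK.
- by move=> i; rewrite subr_ge0 ler_norm.
- exact: abs_summable_norm.
- by apply: abs_summableB => //; exact: abs_summable_norm.
Qed.

Let ge0B a i : 0 <= `|a i| - a i. Proof. by rewrite subr_ge0 ler_norm. Qed.
Let sumB a : abs_summable a -> abs_summable (fun i => `|a i| - a i).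
Proof. by move=> sa; apply: abs_summableB => //; exact: abs_summable_norm. Qed.

Lemma usumD a b : abs_summable a -> abs_summable b ->
  usum (fun i => a i + b i) = usum a + usum b.
Proof.
move=> sa sb; rewrite (usumE sa) (usumE sb).
have na := abs_summable_norm sa; have nb := abs_summable_norm sb.
rewrite addrACA -opprD -!nnsumD//; try by move=> i; exact: ge0B.
- rewrite -usumB.
  + by congr usum; apply/funext => i; ring.
  + by move=> i; rewrite addr_ge0.
  + by move=> i; rewrite addr_ge0 ?ge0B.
  + exact: abs_summableD.
  + by apply: abs_summableD; exact: sumB.
- exact: sumB.
- exact: sumB.
Qed.

Lemma usumZ (c : R) a : abs_summable a -> usum (fun i => c * a i) = c * usum a.
Proof.
move=> sa; rewrite (usumE sa).
have na := abs_summable_norm sa; have da := sumB sa.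
have N0 i : 0 <= `|a i| by [].
have D0 i : 0 <= `|a i| - a i by exact: ge0B.
have [c0|c0] := leP 0 c.
  rewrite mulrBr -(nnsumZ c0 N0 na) -(nnsumZ c0 D0 da) -usumB.
  - by congr usum; apply/funext => i; ring.
  - by move=> i; rewrite mulr_ge0.
  - by move=> i; rewrite mulr_ge0.
  - exact: abs_summableZ.
  - exact: abs_summableZ.
have Nc0 : 0 <= - c by rewrite oppr_ge0 ltW.
have -> : forall x y : R, c * (x - y) = (- c) * y - (- c) * x by move=> *; ring.
rewrite -(nnsumZ Nc0 N0 na) -(nnsumZ Nc0 D0 da) -usumB.
- by congr usum; apply/funext => i; ring.
- by move=> i; rewrite mulr_ge0.
- by move=> i; rewrite mulr_ge0.
- exact: abs_summableZ.
- exact: abs_summableZ.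
Qed.

(** The subtracted sum of [|a| - a] lies between [0] and twice the sum of
    [|a|]. *)
Lemma le_norm_usum a : abs_summable a ->
  (`|usum a|%:E <= \esum_(i in [set: I]) `|a i|%:E)%E.
Proof.
move=> sa; have na := abs_summable_norm sa.
rewrite nnsumE// lee_fin usumE// ler_norml.
have h0 : 0 <= nnsum (fun i => `|a i| - a i) by apply: nnsum_ge0 => i; exact: ge0B.
have : nnsum (fun i => `|a i| - a i) <= nnsum (fun i => 2 * `|a i|).
  apply: le_nnsum => [i|]; last exact: abs_summableZ.
  by rewrite ge0B/=; have := ler_norm (- a i); rewrite normrN; lra.
rewrite nnsumZ//; lra.
Qed.

End Family.

Section Products.
Variables I J : choiceType.

Lemma esum_prod (a : I -> R) (b : J -> R) :
  (forall i, 0 <= a i) -> (forall j, 0 <= b j) ->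
  (\esum_(j in [set: J]) (b j)%:E < +oo)%E ->
  (\esum_(k in [set: I * J]) (a k.1 * b k.2)%:E =
   (\esum_(i in [set: I]) (a i)%:E) * \esum_(j in [set: J]) (b j)%:E)%E.
Proof.
move=> a0 b0 sb.
have sb' : abs_summable b.
  by apply: le_lt_trans sb; apply: le_esum => j _; rewrite ger0_norm.
have -> : [set: I * J] = [set: I] `*`` (fun=> [set: J]).
  by apply/seteqP; split => // -[].
rewrite -(@esum_esum _ _ _ _ _ (fun i j => (a i * b j)%:E)); last first.
  by move=> i j _ _; rewrite lee_fin mulr_ge0.
transitivity (\esum_(i in [set: I]) ((nnsum b)%:E * (a i)%:E))%E.
  apply: eq_esum => i _; under eq_esum do rewrite EFinM.
  by rewrite esumZl// nnsumE// muleC.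
rewrite (nnsumE b0 sb') muleC esumZl ?nnsum_ge0// => i; by rewrite lee_fin.
Qed.

Lemma abs_summable_prod (a : I -> R) (b : J -> R) :
  abs_summable a -> abs_summable b -> abs_summable (fun k : I * J => a k.1 * b k.2).
Proof.
move=> sa sb; rewrite /abs_summable; under eq_esum do rewrite normrM.
rewrite (@esum_prod (fun i => `|a i|) (fun j => `|b j|))//.
rewrite (@nnsumE _ (fun i => `|a i|))//; last exact: abs_summable_norm.
by rewrite (@nnsumE _ (fun i => `|b i|)) -?EFinM ?ltry//; exact: abs_summable_norm.
Qed.

Lemma nnsum_prod (a : I -> R) (b : J -> R) :
  (forall i, 0 <= a i) -> (forall j, 0 <= b j) ->
  abs_summable a -> abs_summable b ->
  nnsum (fun k : I * J => a k.1 * b k.2) = nnsum a * nnsum b.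
Proof.
move=> a0 b0 sa sb; rewrite /nnsum esum_prod//; last by rewrite nnsumE// ltry.
by rewrite (nnsumE a0 sa) (nnsumE b0 sb).
Qed.

(** Products of the decompositions [|a| - (|a| - a)] and [|b| - (|b| - b)]
    expand into four nonnegative product families, to which the
    unsigned product formula applies. *)
Lemma usum_prod (a : I -> R) (b : J -> R) :
  abs_summable a -> abs_summable b ->
  usum (fun k : I * J => a k.1 * b k.2) = usum a * usum b.
Proof.
move=> sa sb; rewrite (usumE sa) (usumE sb).
have na := abs_summable_norm sa; have nb := abs_summable_norm sb.
have da := abs_summableB na sa; have db := abs_summableB nb sb.
have pa i : 0 <= `|a i| - a i by rewrite subr_ge0 ler_norm.
have pb i : 0 <= `|b i| - b i by rewrite subr_ge0 ler_norm.
have -> : forall x y z t : R, (x - y) * (z - t) = (x * z + y * t) - (x * t + y * z).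
  by move=> *; ring.
have mul0 (f : I -> R) (g : J -> R) : (forall i, 0 <= f i) -> (forall i, 0 <= g i) ->
  forall i : I * J, 0 <= f i.1 * g i.2 by move=> *; rewrite mulr_ge0.
have ms := abs_summable_prod.
have pna i : 0 <= `|a i| by []. have pnb i : 0 <= `|b i| by [].
rewrite -(nnsum_prod pna pnb na nb) -(nnsum_prod pa pb da db).
rewrite -(nnsum_prod pna pb na db) -(nnsum_prod pa pnb da nb).
rewrite -(nnsumD (mul0 _ _ pna pnb) (mul0 _ _ pa pb) (ms _ _ na nb) (ms _ _ da db)).
rewrite -(nnsumD (mul0 _ _ pna pb) (mul0 _ _ pa pnb) (ms _ _ na db) (ms _ _ da nb)).
rewrite -usumB.
- by congr usum; apply/funext => i; ring.
- by move=> i; rewrite addr_ge0 ?mulr_ge0.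
- by move=> i; rewrite addr_ge0 ?mulr_ge0.
- exact: abs_summableD (ms _ _ na nb) (ms _ _ da db).
- exact: abs_summableD (ms _ _ na db) (ms _ _ da nb).
Qed.

End Products.

Lemma usum_reindex (I J : choiceType) (e : I -> J) (a : J -> R) :
  bijective e -> usum a = usum (a \o e).
Proof.
move=> be; have se : set_bij [set: I] [set: J] e by rewrite setTT_bijective.
rewrite /usum !(@reindex_esum _ _ _ _ _ _ _ se).
by congr (fine (_ - _)); apply: eq_esum => i _; rewrite ?funeposE ?funenegE.
Qed.

Lemma esum_reindex (I J : choiceType) (e : I -> J) (a : J -> \bar R) :
  bijective e -> (\esum_(j in [set: J]) a j = \esum_(i in [set: I]) a (e i))%E.
Proof.
by move=> be; apply: reindex_esum; rewrite setTT_bijective.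
Qed.

Section Rows.

(** The bijection that lets sums over integer rows be computed by induction on
    the length of the row. *)
Definition row_cons d (km : int * 'rV[int]_d) : 'rV[int]_d.+1 :=
  \row_i (if unlift ord0 i is Some j then km.2 0 j else km.1).

Lemma row_cons_bij d : bijective (@row_cons d).
Proof.
exists (fun m : 'rV[int]_d.+1 => (m 0 ord0, \row_i m 0 (lift ord0 i))).
  case=> k m; rewrite !mxE unlift_none; congr pair.
  by apply/rowP => i; rewrite !mxE liftK.
move=> m; apply/rowP => i; rewrite !mxE.
by case: unliftP => [j ->|->]; rewrite ?mxE.
Qed.

Lemma prod_row_cons d (a : 'I_d.+1 -> int -> R) km :
  \prod_i a i (row_cons km 0 i) =
  a ord0 km.1 * \prod_i a (lift ord0 i) (km.2 0 i).
Proof.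
rewrite big_ord_recl !mxE unlift_none; congr (_ * _).
by apply: eq_bigr => i _; rewrite !mxE liftK.
Qed.

Let set_rV0 : [set: 'rV[int]_0] = [set 0].
Proof. by apply/seteqP; split => // m _; apply/rowP => -[]. Qed.

Lemma prod_ereal_lty (J : Type) (r : seq J) (x : J -> \bar R) :
  (forall j, 0 <= x j < +oo)%E -> (0 <= \prod_(j <- r) x j < +oo)%E.
Proof.
move=> x0; elim/big_ind: _ => [|y z /andP[y0 yoo] /andP[z0 zoo]|j _] //.
  by rewrite lee_fin ler01 ltry.
rewrite mule_ge0//=; apply: lte_mul_pinfty => //.
by rewrite ge0_fin_numE.
Qed.

Lemma esum_prod_row d (a : 'I_d -> int -> R) :
  (forall i k, 0 <= a i k) ->
  (forall i, \esum_(k in [set: int]) (a i k)%:E < +oo)%E ->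
  (\esum_(m in [set: 'rV[int]_d]) (\prod_i a i (m 0 i))%:E =
   \prod_i \esum_(k in [set: int]) (a i k)%:E)%E.
Proof.
elim: d a => [|d IH] a a0 sa.
  by rewrite set_rV0 esum_set1 !big_ord0// lee_fin.
rewrite (esum_reindex _ (@row_cons_bij d)) big_ord_recl -IH//.
under eq_esum do rewrite prod_row_cons.
rewrite (@esum_prod _ _ (a ord0) (fun m : 'rV_d => \prod_i a (lift ord0 i) (m 0 i)))//.
  by move=> m; apply: prodr_ge0.
rewrite (IH (fun i => a (lift ord0 i)))//.
have /andP[] // : (0 <= \prod_i (\esum_(k in [set: int]) (a (lift ord0 i) k)%:E) < +oo)%E.
apply: prod_ereal_lty => i; rewrite sa andbT.
by apply: esum_ge0 => k _; rewrite lee_fin.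
Qed.

Lemma abs_summable_prod_row d (a : 'I_d -> int -> R) :
  (forall i, abs_summable (a i)) ->
  abs_summable (fun m : 'rV[int]_d => \prod_i a i (m 0 i)).
Proof.
move=> sa; rewrite /abs_summable; under eq_esum do rewrite normr_prod.
rewrite (@esum_prod_row _ (fun i k => `|a i k|))//.
have /andP[] // : (0 <= \prod_i (\esum_(k in [set: int]) `|a i k|%:E) < +oo)%E.
apply: prod_ereal_lty => i; apply/andP; split; last exact: sa.
by apply: esum_ge0 => k _; rewrite lee_fin.
Qed.

Lemma usum_prod_row d (a : 'I_d -> int -> R) : (forall i, abs_summable (a i)) ->
  usum (fun m : 'rV[int]_d => \prod_i a i (m 0 i)) = \prod_i usum (a i).
Proof.
elim: d a => [|d IH] a sa.
  have fin (c : R) : abs_summable (fun _ : 'rV[int]_0 => c).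
    by rewrite /abs_summable set_rV0 esum_set1 ?lee_fin// ltry.
  have -> : (fun m : 'rV[int]_0 => \prod_i a i (m 0 i)) = (fun=> 1 - 0).
    by apply/funext => m; rewrite big_ord0 subr0.
  by rewrite usumB// /nnsum set_rV0 !esum_set1 ?lee_fin// subr0 big_ord0.
rewrite (usum_reindex _ (@row_cons_bij d)) big_ord_recl -IH//.
rewrite -usum_prod//; last exact: (abs_summable_prod_row (fun i => sa (lift ord0 i))).
by congr usum; apply/funext => km /=; rewrite prod_row_cons.
Qed.
End Rows.

(** For weights of total mass one, the error of the weighted sum is the weighted
    sum of the errors; this is what the normalization of the kernels is
    for. *)
Lemma usum_perturb (I : choiceType) (W c G : I -> R) (y : R) :
  abs_summable W -> usum W = 1 -> (forall i, `|c i - y| <= G i) ->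
  (\esum_(i in [set: I]) (`|W i| * G i)%:E < +oo)%E ->
  abs_summable (fun i => W i * c i) /\
  (`|usum (fun i => W i * c i) - y|%:E
     <= \esum_(i in [set: I]) (`|W i| * G i)%:E)%E.
Proof.
move=> sW W1 cG sG.
have le_i i : `|W i * (c i - y)| <= `|W i| * G i by rewrite normrM ler_wpM2l.
have sd : abs_summable (fun i => W i * (c i - y)) by exact: le_abs_summable sG.
have sy : abs_summable (fun i => y * W i) by exact: abs_summableZ.
have -> : (fun i => W i * c i) = (fun i => W i * (c i - y) + y * W i).
  by apply/funext => i; ring.
split; first exact: abs_summableD.
rewrite usumD// usumZ// W1 mulr1 addrK.
apply: le_trans (le_norm_usum sd) _.
by apply: le_esum => i _; rewrite lee_fin.
Qed.
End Sums.

(** * Integrals of continuous functions over cells *)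

Section Integrals.
Variable R : realType.
Notation mu := (@lebesgue_measure R).

Lemma continuous_pair (T U V : topologicalType) (f : T -> U) (g : T -> V) x :
  {for x, continuous f} -> {for x, continuous g} ->
  {for x, continuous (fun t => (f t, g t))}.
Proof. by move=> cf cg; apply: cvg_pair. Qed.

Section OneVariable.
Variables (c e : R) (ce : c <= e).

Lemma continuous_segment_integrable (g : R -> R) : continuous g ->
  mu.-integrable `[c, e] (EFin \o g).
Proof.
move=> cg; apply: continuous_compact_integrable; first exact: segment_compact.
exact: continuous_subspaceT.
Qed.

Lemma segment_length : fine (mu `[c, e]) = e - c.
Proof.
rewrite lebesgue_measure_itv/= lte_fin; case: ltP => //= h.
by apply/esym/eqP; rewrite subr_eq0 eq_le h ce.
Qed.

Lemma le_norm_segment_integral (g : R -> R) (M : R) : continuous g ->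
  (forall t, c <= t <= e -> `|g t| <= M) ->
  `|\int[mu]_(t in `[c, e]) g t| <= M * (e - c).
Proof.
move=> cg gM; have ig := continuous_segment_integrable cg.
apply: le_trans (le_normr_Rintegral _ ig) _ => //.
rewrite -segment_length -Rintegral_cst//; apply: le_Rintegral => //.
- by apply: continuous_segment_integrable => t; apply: cvg_norm; exact: cg.
- by apply: continuous_segment_integrable => t; exact: cvg_cst.
Qed.

(** Compactness of the segment makes the convergence of the integrand uniform
    in the integration variable. *)
Lemma continuous_segment_integral (T : topologicalType) (G : T * R -> R) :
  continuous G -> continuous (fun x => \int[mu]_(t in `[c, e]) G (x, t)).
Proof.
move=> cG x0; apply/cvgrPdist_le => eps eps0.
have cGx x : continuous (fun t => G (x, t)).
  move=> t; apply: (@continuous_comp _ _ _ (fun t => (x, t)) G); last exact: cG.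
  by apply: continuous_pair; [exact: cvg_cst|exact: cvg_id].
pose del := eps / (e - c + 1).
have ec0 : 0 < e - c + 1 by rewrite ltr_wpDl// subr_ge0.
have del0 : 0 < del by rewrite divr_gt0.
have : \forall x \near x0, `[c, e] `<=` (fun t => `|G (x0, t) - G (x, t)| <= del).
  apply: ((compact_near_coveringP _).1 (@segment_compact _ c e)) => t _.
  have cD : continuous (fun z : R * T => G (x0, z.1) - G (z.2, z.1)).
    move=> z; apply: cvgB.
      apply: (@continuous_comp _ _ _ (fun z : R * T => (x0, z.1)) G); last exact: cG.
      by apply: continuous_pair; [exact: cvg_cst|exact: cvg_fst].
    apply: (@continuous_comp _ _ _ (fun z : R * T => (z.2, z.1)) G); last exact: cG.
    by apply: continuous_pair; [exact: cvg_snd|exact: cvg_fst].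
  have := cD (t, x0); rewrite /continuous_at /= subrr.
  by move/cvgr0Pnorm_le => /(_ _ del0).
apply: filterS => x hx.
rewrite -RintegralB//; [|exact: continuous_segment_integrable..].
apply: le_trans (le_norm_segment_integral (M := del) _ _) _.
- by move=> t; apply: cvgB; exact: cGx.
- by move=> t t_ce; apply: hx; rewrite /= in_itv.
rewrite /del mulrAC ler_pdivrMr// ler_pM2l//; lra.
Qed.

End OneVariable.

Section Box.
Variable d : nat.
Implicit Types (a b v : 'rV[R]_d) (s : seq 'I_d) (F : 'rV[R]_d -> R).

Lemma set_coordE v i t : set_coord v i t = v + (t - v 0 i) *: delta_mx 0 i.
Proof.
apply/rowP => k; rewrite !mxE eqxx/=.
by case: eqVneq => [->|]; rewrite ?mulr1 ?mulr0 ?addr0// addrC subrK.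
Qed.

Lemma continuous_set_coord i :
  continuous (fun z : 'rV[R]_d * R => set_coord z.1 i z.2).
Proof.
move=> z; under eq_fun do rewrite set_coordE.
apply: cvgD; first exact: cvg_fst.
apply: cvgZr_tmp; apply: cvgB; first exact: cvg_snd.
apply: (@continuous_comp _ _ _ (fun z : 'rV[R]_d * R => z.1) (fun v => v 0 i)).
  exact: cvg_fst.
exact: coord_continuous.
Qed.

(** The fold of [box_integral], with the list of axes and the starting vector
    left free so that inductions on the axes go through. *)
Definition iter_integral a b s F : 'rV[R]_d -> R :=
  foldr (fun i G v => \int[mu]_(t in `[a 0 i, b 0 i]) G (set_coord v i t)) F s.

(** The parameter space [T] accounts for the outer variable of a cell: the box
    integral has to be continuous in it to be integrated again. *)
Lemma continuous_iter_integral (T : topologicalType) a b s (F : T * 'rV[R]_d -> R) :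
  (forall i, a 0 i <= b 0 i) -> continuous F ->
  continuous (fun z : T * 'rV[R]_d => iter_integral a b s (fun v => F (z.1, v)) z.2).
Proof.
move=> ab cF; elim: s => [|i s IH] /=.
  by rewrite (_ : (fun z => _) = F)//; apply/funext => -[].
pose G (y : T * 'rV[R]_d * R) :=
  iter_integral a b s (fun v => F (y.1.1, v)) (set_coord y.1.2 i y.2).
apply: (@continuous_segment_integral _ _ (ab i) _ G) => y.
apply: (@continuous_comp _ _ _
  (fun y : T * 'rV[R]_d * R => (y.1.1, set_coord y.1.2 i y.2)) _ _ _ (IH _)).
apply: continuous_pair.
  by apply: (@continuous_comp _ _ _ (fst : T * 'rV[R]_d * R -> _) fst); exact: cvg_fst.
apply: (@continuous_comp _ _ _ (fun y : T * 'rV[R]_d * R => (y.1.2, y.2)) _ _ _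
  (@continuous_set_coord i _)).
apply: continuous_pair; last exact: cvg_snd.
apply: (@continuous_comp _ _ _ (fst : T * 'rV[R]_d * R -> _) snd); first exact: cvg_fst.
exact: cvg_snd.
Qed.

Lemma continuous_iter_integral_set a b s i F v :
  (forall i, a 0 i <= b 0 i) -> continuous F ->
  continuous (fun t => iter_integral a b s F (set_coord v i t)).
Proof.
move=> ab cF t.
have c2 : continuous (fun z : R * 'rV[R]_d => F z.2).
  move=> z; apply: (@continuous_comp _ _ _ (snd : R * 'rV[R]_d -> _) F); last exact: cF.
  exact: cvg_snd.
have := continuous_iter_integral (s := s) ab c2 => /(_ (0, set_coord v i t)) /= c3.
apply: (@continuous_comp _ _ _ (fun t => (0 : R, set_coord v i t)) _ _ _ c3).
apply: continuous_pair; first exact: cvg_cst.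
apply: (@continuous_comp _ _ _ (fun t => (v, t)) _ _ _ (@continuous_set_coord i _)).
by apply: continuous_pair; [exact: cvg_cst|exact: cvg_id].
Qed.

Lemma iter_integralD a b s F1 F2 v : (forall i, a 0 i <= b 0 i) ->
  continuous F1 -> continuous F2 ->
  iter_integral a b s (fun v => F1 v + F2 v) v =
  iter_integral a b s F1 v + iter_integral a b s F2 v.
Proof.
move=> ab c1 c2; elim: s v => //= i s IH v.
under eq_Rintegral do rewrite IH.
by rewrite RintegralD//; apply: continuous_segment_integrable => //;
  exact: continuous_iter_integral_set.
Qed.

Lemma iter_integralZ a b s r F v : (forall i, a 0 i <= b 0 i) ->
  continuous F ->
  iter_integral a b s (fun v => r * F v) v = r * iter_integral a b s F v.
Proof.
move=> ab c1; elim: s v => //= i s IH v.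
under eq_Rintegral do rewrite IH.
by rewrite RintegralZl//; apply: continuous_segment_integrable => //;
  exact: continuous_iter_integral_set.
Qed.

Lemma iter_integral_cst a b s r v : (forall i, a 0 i <= b 0 i) ->
  iter_integral a b s (fun=> r) v = r * \prod_(i <- s) (b 0 i - a 0 i).
Proof.
move=> ab; elim: s v => [|i s IH] v; first by rewrite big_nil mulr1.
rewrite big_cons/=; under eq_Rintegral do rewrite IH.
by rewrite Rintegral_cst// segment_length// mulrA mulrAC.
Qed.

(** The coordinates not yet integrated out have to lie in the box; the ones in
    [s] are overwritten. *)
Lemma le_norm_iter_integral a b s F M v : (forall i, a 0 i <= b 0 i) ->
  continuous F ->
  (forall v', (forall i, a 0 i <= v' 0 i <= b 0 i) -> `|F v'| <= M) ->
  (forall i, i \notin s -> a 0 i <= v 0 i <= b 0 i) ->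
  `|iter_integral a b s F v| <= M * \prod_(i <- s) (b 0 i - a 0 i).
Proof.
move=> ab cF FM; elim: s v => [|i s IH] v vab /=.
  by rewrite big_nil mulr1; apply: FM => i; exact: vab.
rewrite big_cons mulrCA mulrC; apply: le_norm_segment_integral => //.
  exact: continuous_iter_integral_set.
move=> t tab; apply: IH => k ks; rewrite !mxE; case: eqVneq => [->//|ki].
by apply: vab; rewrite inE negb_or ki.
Qed.

End Box.

Section Cell.
Variables (d : nat) (u0 u1 : R) (a b : 'rV[R]_d).
Hypotheses (u01 : u0 <= u1) (ab : forall i, a 0 i <= b 0 i).
Implicit Types F : R * 'rV[R]_d -> R.

Definition cell_integral F : R :=
  \int[mu]_(u in `[u0, u1]) box_integral a b (fun v => F (u, v)).

Definition cell_volume : R := (u1 - u0) * \prod_i (b 0 i - a 0 i).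

Lemma continuous_section F u : continuous F -> continuous (fun v => F (u, v)).
Proof.
move=> cF v; apply: (@continuous_comp _ _ _ (fun v => (u, v)) F); last exact: cF.
by apply: (@continuous_pair _ _ _ (fun=> u) id); [exact: cst_continuous|exact: cvg_id].
Qed.

Lemma continuous_box_integral F : continuous F ->
  continuous (fun u => box_integral a b (fun v => F (u, v))).
Proof.
move=> cF u.
have c3 := @continuous_iter_integral _ _ _ _ (enum 'I_d) _ ab cF (u, 0).
apply: (@continuous_comp _ _ _ (fun u => (u, 0 : 'rV[R]_d)) _ _ _ c3).
by apply: continuous_pair; [exact: cvg_id|exact: cvg_cst].
Qed.

Lemma cell_integralD F1 F2 : continuous F1 -> continuous F2 ->
  cell_integral (fun q => F1 q + F2 q) = cell_integral F1 + cell_integral F2.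
Proof.
move=> c1 c2; rewrite /cell_integral -RintegralD//; last 2 first.
- by apply: continuous_segment_integrable => //; exact: continuous_box_integral.
- by apply: continuous_segment_integrable => //; exact: continuous_box_integral.
apply: eq_Rintegral => u _.
by apply: iter_integralD => //; exact: continuous_section.
Qed.

Lemma cell_integralZ r F : continuous F ->
  cell_integral (fun q => r * F q) = r * cell_integral F.
Proof.
move=> c1; rewrite /cell_integral -RintegralZl//; last first.
  by apply: continuous_segment_integrable => //; exact: continuous_box_integral.
apply: eq_Rintegral => u _.
by apply: iter_integralZ => //; exact: continuous_section.
Qed.

Lemma cell_integral_cst r : cell_integral (fun=> r) = r * cell_volume.
Proof.
rewrite /cell_integral; under eq_Rintegral do
  rewrite [box_integral _ _ _](iter_integral_cst (enum 'I_d) r 0 ab) big_enum/=.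
by rewrite Rintegral_cst// segment_length// /cell_volume -mulrA [_ * (u1 - _)]mulrC.
Qed.

Lemma cell_integral_sum (I : Type) (s : seq I) (P : pred I) (G : I -> R * 'rV[R]_d -> R) :
  (forall i, P i -> continuous (G i)) ->
  continuous (fun q => \sum_(i <- s | P i) G i q) /\
  cell_integral (fun q => \sum_(i <- s | P i) G i q) =
  \sum_(i <- s | P i) cell_integral (G i).
Proof.
move=> cG; elim: s => [|i s [cs IH]].
  rewrite big_nil; under eq_fun do rewrite big_nil.
  split; first by move=> q; exact: cvg_cst.
  by rewrite cell_integral_cst mul0r.
rewrite big_cons; have [Pi|nPi] := boolP (P i); last first.
  have -> : (fun q => \sum_(i <- (i :: s) | P i) G i q) = (fun q => \sum_(i <- s | P i) G i q).
    by apply/funext => q; rewrite big_cons (negbTE nPi).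
  by split.
have -> : (fun q => \sum_(i <- (i :: s) | P i) G i q) =
    (fun q => G i q + \sum_(i <- s | P i) G i q).
  by apply/funext => q; rewrite big_cons Pi.
split; first by move=> q; apply: cvgD; [exact: cG|exact: cs].
by rewrite cell_integralD ?IH//; exact: cG.
Qed.

Lemma le_norm_cell_integral F M : continuous F ->
  (forall u (v : 'rV[R]_d), u0 <= u <= u1 -> (forall i, a 0 i <= v 0 i <= b 0 i) ->
     `|F (u, v)| <= M) ->
  `|cell_integral F| <= M * cell_volume.
Proof.
move=> cF FM; rewrite /cell_volume mulrCA mulrC.
apply: le_norm_segment_integral => //; first exact: continuous_box_integral.
move=> u u_in; rewrite -big_enum/=.
apply: le_norm_iter_integral => //.
- exact: continuous_section.
- by move=> v v_in; exact: FM.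
- by move=> i; rewrite mem_enum.
Qed.

End Cell.
End Integrals.

(** * Taylor expansion along the axes *)

Section Taylor1.
Variable R : realType.

(** Rolle's theorem for end points in either order. The point found differs
    from [x], so that powers of [x - c] can be cancelled. *)
Lemma Rolle_strictly_between (h dh : R -> R) (u x : R) : u != x ->
  (forall t : R, is_derive t 1 h (dh t)) -> h u = h x ->
  exists2 c, `|c - u| <= `|x - u| /\ c != x & dh c = 0.
Proof.
move=> ux hd hux.
have dd t : derivable h t 1 by case: (hd t).
have ch a b : {within `[a, b], continuous h}.
  apply: continuous_subspaceT => t.
  exact/differentiable_continuous/derivable1_diffP.
have key a b : a < b -> h a = h b -> exists2 c, a < c < b & dh c = 0.
  move=> ab hab; have [c cab dc] := Rolle ab (fun t _ => dd t) (@ch a b) hab.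
  exists c; first by rewrite in_itv in cab.
  by have := @derive_val _ _ _ _ _ _ _ dc; rewrite (@derive_val _ _ _ _ _ _ _ (hd c)).
move: ux; rewrite neq_lt => /orP[lt|lt].
  have [c /andP[uc cx] dc] := key _ _ lt hux; exists c => //; split.
    by rewrite !gtr0_norm ?subr_gt0//; lra.
  by rewrite lt_eqF.
have [c /andP[uc cx] dc] := key _ _ lt (esym hux); exists c => //; split.
  by rewrite !ltr0_norm ?subr_lt0//; lra.
by rewrite gt_eqF.
Qed.

Lemma is_derive_power_sub (x t : R) k :
  is_derive t 1 (fun t => (x - t) ^+ k.+1) (- (k.+1%:R * (x - t) ^+ k)).
Proof.
have hd : is_derive t 1 (fun t => x - t) (-1).
  have := @is_deriveB _ _ _ (cst x) id t 1 0 1 _ _.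
  by rewrite sub0r; apply.
have := @is_deriveX _ _ _ k.+1 t 1 _ hd.
rewrite (_ : (fun t => x - t) ^+ k.+1 = (fun t => (x - t) ^+ k.+1)).
  by move=> /is_derive_eq; apply; rewrite -[_ *: _]/(_ * _) mulrN1.
by apply/funext => s; rewrite fctE.
Qed.

(** Differentiating in the expansion point, consecutive terms cancel and only
    the last one survives. *)
Lemma is_derive_taylor_sum (G : nat -> R -> R) (x t : R) n :
  (forall k, (k <= n)%N -> forall s : R, is_derive s 1 (G k) (G k.+1 s)) ->
  is_derive t 1 (fun t => \sum_(k < n.+1) G k t * (x - t) ^+ k / k`!%:R)
    (G n.+1 t * (x - t) ^+ n / n`!%:R).
Proof.
elim: n => [|n IH] hG.
  rewrite (_ : (fun t => _) = G 0%N).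
    by apply: is_derive_eq (hG 0%N _ _) _ => //; rewrite expr0 mulr1 divr1.
  by apply/funext => s; rewrite big_ord1 expr0 mulr1 divr1.
have {}IH := IH (fun k hk => hG k (leqW hk)).
have hM := @is_deriveM _ _ _ _ t 1 _ _ (hG n.+1 (leqnn _) t) (is_derive_power_sub x t n).
have hZ := @is_deriveZ _ _ _ _ (n.+1)`!%:R^-1 t 1 _ hM.
have := is_deriveD IH hZ.
rewrite (_ : _ + _ = (fun t => \sum_(k < n.+2) G k t * (x - t) ^+ k / k`!%:R)).
  move=> /is_derive_eq; apply.
  rewrite -![_ *: _]/(_ * _) factS natrM exprS.
  have n0 : n`!%:R != 0 :> R by rewrite pnatr_eq0 -lt0n fact_gt0.
  have n1 : n.+1%:R != 0 :> R by rewrite pnatr_eq0.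
  by field; rewrite n0 nat1r n1.
apply/funext => s; rewrite big_ord_recr/= !fctE; congr (_ + _).
by rewrite [RHS]mulrC.
Qed.

(** Lagrange's form of the remainder, stated for a sequence [G] of successive
    derivatives and without assuming an order between [u] and [x]. *)
Lemma taylor_lagrange (G : nat -> R -> R) n (u x : R) :
  (forall k, (k < n)%N -> forall s : R, is_derive s 1 (G k) (G k.+1 s)) ->
  exists2 xi, `|xi - u| <= `|x - u| &
    G 0%N x = \sum_(k < n) G k u * (x - u) ^+ k / k`!%:R +
              G n xi * (x - u) ^+ n / n`!%:R.
Proof.
case: n => [|n] hG.
  by exists x => //; rewrite big_ord0 add0r expr0 mulr1 divr1.
have [<-|ux] := eqVneq u x.
  exists u => //; rewrite subrr big_ord_recl expr0 mulr1 divr1 big1 ?addr0.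
    by rewrite exprS mul0r mulr0 mul0r addr0.
  by move=> i _; rewrite lift0 exprS mul0r mulr0 mul0r.
have xu0 : x - u != 0 by rewrite subr_eq0 eq_sym.
pose T t := \sum_(k < n.+1) G k t * (x - t) ^+ k / k`!%:R.
(* A is chosen so that h takes the same value at u and at x; Rolle's theorem
   then identifies it with G n.+1 c / (n.+1)!. *)
pose A := (G 0%N x - T u) / (x - u) ^+ n.+1.
pose h t := T t + A * (x - t) ^+ n.+1.
have hd (t : R) : is_derive t 1 h
    (G n.+1 t * (x - t) ^+ n / n`!%:R - A * (n.+1%:R * (x - t) ^+ n)).
  have h1 := is_derive_taylor_sum x t (fun k hk => hG k hk).
  have h2 := @is_deriveZ _ _ _ _ A t 1 _ (is_derive_power_sub x t n).
  have := is_deriveD h1 h2.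
  rewrite (_ : _ + _ = h); last by apply/funext.
  by move=> /is_derive_eq; apply; rewrite -[_ *: _]/(_ * _) mulrN.
have Tx : T x = G 0%N x.
  rewrite /T big_ord_recl subrr expr0 mulr1 divr1 big1 ?addr0// => i _.
  by rewrite lift0 exprS mul0r mulr0 mul0r.
have hux : h u = h x.
  rewrite /h Tx subrr expr0n mulr0 addr0 /A divfK ?expf_neq0//.
  by rewrite addrC subrK.
have [c [cu cx] dc] := Rolle_strictly_between ux hd hux.
exists c => //.
have xc0 : (x - c) ^+ n != 0 by rewrite expf_neq0// subr_eq0 eq_sym.
have n0 : n`!%:R != 0 :> R by rewrite pnatr_eq0 -lt0n fact_gt0.
have n1 : n.+1%:R != 0 :> R by rewrite pnatr_eq0.
have AE : A = G n.+1 c / (n.+1)`!%:R.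
  rewrite factS natrM; apply: (mulfI xc0); move/eqP: dc; rewrite subr_eq0 => /eqP e.
  apply: (mulfI n1); transitivity (A * (n.+1%:R * (x - c) ^+ n)); first by ring.
  by rewrite -e; field; rewrite n0 nat1r n1.
rewrite mulrAC -AE -/(T u) /A divfK ?expf_neq0//; ring.
Qed.

End Taylor1.

Section MultiIndex.
Variables (R : realType) (d : nat).
Implicit Types (s : seq 'I_d) (P : pred nat) (F : nat -> ('I_d -> nat) -> R)
  (j : 'I_d -> nat).

Definition supported s j := [forall i, (i \notin s) ==> (j i == 0%N)].

(** Sums over the multi-indices [(l, j)] whose weight satisfies [P] and whose
    [y]-part is carried by [s]. Support is imposed on functions on all axes
    instead of using functions on [s], so that the sums for [s = enum 'I_d] become
    those of the operator. *)
Definition multi_sum N s P F : R :=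
  \sum_(l < N.+1) \sum_(j : {ffun 'I_d -> 'I_N.+1} |
     P (l + \sum_i j i)%N && supported s (fun i => j i)) F l (fun i => j i).

Definition set_order j b k : 'I_d -> nat := fun i => if i == b then k else j i.

Lemma supportedP s j : reflect (forall i, i \notin s -> j i = 0%N) (supported s j).
Proof.
apply: (iffP forallP) => [h i his|h i]; first by have /implyP/(_ his)/eqP := h i.
by apply/implyP => /h ->.
Qed.

Lemma supported_set_order s b j k : supported s j -> supported (rcons s b) (set_order j b k).
Proof.
move=> /supportedP js; apply/supportedP => i; rewrite mem_rcons inE negb_or /set_order.
by case: eqVneq => //= _; exact: js.
Qed.

Lemma sum_set_order j b k : j b = 0%N -> (\sum_i set_order j b k i = \sum_i j i + k)%N.
Proof.
move=> jb; rewrite (bigD1 b)//= [in RHS](bigD1 b)//= jb add0n addnC /set_order eqxx.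
by congr (_ + _)%N; apply: eq_bigr => i /negbTE ->.
Qed.

Lemma eq_multi_sum N s P1 P2 F1 F2 :
  (forall l j, supported s j -> P1 (l + \sum_i j i)%N = P2 (l + \sum_i j i)%N) ->
  (forall l j, supported s j -> P2 (l + \sum_i j i)%N -> F1 l j = F2 l j) ->
  multi_sum N s P1 F1 = multi_sum N s P2 F2.
Proof.
move=> eP eF; apply: eq_bigr => l _; apply: eq_big => j.
  by have [sj|] := boolP (supported s _); rewrite ?andbF// !andbT eP.
move=> /andP[Pj sj]; apply: eF => //; by rewrite -eP.
Qed.

Lemma multi_sumZ N s P F (r : R) : multi_sum N s P (fun l j => r * F l j) = r * multi_sum N s P F.
Proof.
by rewrite mulr_sumr; apply: eq_bigr => l _; rewrite mulr_sumr.
Qed.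

Lemma multi_sum_pred0 N s P F : (forall t, ~~ P t) -> multi_sum N s P F = 0.
Proof.
by move=> P0; apply: big1 => l _; apply: big1 => j; rewrite (negbTE (P0 _)).
Qed.

Lemma sum_ord_vanish A B (G : nat -> R) :
  (forall k, (A <= k)%N -> G k = 0) -> (forall k, (B <= k)%N -> G k = 0) ->
  \sum_(k < A) G k = \sum_(k < B) G k.
Proof.
wlog AB : A B / (A <= B)%N => [H|] gA gB.
  by have [AB|/ltnW BA] := leqP A B; [exact: H|symmetry; exact: H].
rewrite (big_ord_widen _ G AB) big_mkcond/=; apply: eq_bigr => k _.
by case: ltnP => // /gA.
Qed.

(** The order of differentiation along the last axis of the list is split off;
    [M] may be any bound on the total weight selected by [P], so that the range
    of that order does not depend on the encoding bound [N]. *)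
Lemma multi_sum_rcons N M s b P F : b \notin s ->
  (forall t, P t -> (t <= N)%N) -> (forall t, P t -> (t < M)%N) ->
  multi_sum N (rcons s b) P F =
  \sum_(k < M) multi_sum N s (fun t => P (t + k)%N) (fun l j => F l (set_order j b k)).
Proof.
move=> bs PN PM.
pose G k := multi_sum N s (fun t => P (t + k)%N) (fun l j => F l (set_order j b k)).
transitivity (\sum_(k < N.+1) G k); last first.
  apply: (sum_ord_vanish (G := G)) => k kb; apply: multi_sum_pred0 => t; apply/negP.
    by move=> /PN; apply/negP; rewrite -ltnNge (leq_trans kb)// leq_addl.
  by move=> /PM; apply/negP; rewrite -leqNgt (leq_trans kb)// leq_addl.
rewrite exchange_big/=; apply: eq_bigr => l _.
rewrite (partition_big (fun j : {ffun 'I_d -> 'I_N.+1} => j b) predT)//=.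
apply: eq_bigr => k _.
pose h (k : 'I_N.+1) (j : {ffun 'I_d -> 'I_N.+1}) : {ffun 'I_d -> 'I_N.+1} :=
  [ffun i => if i == b then k else j i].
(* Multi-indices with b-entry k correspond to multi-indices with b-entry 0. *)
rewrite (reindex_onto (h k) (h ord0)); last first.
  move=> j /andP[_ /eqP jb]; apply/ffunP => i; rewrite !ffunE.
  by case: eqVneq => // ->.
have hupd (g : {ffun 'I_d -> 'I_N.+1}) : (fun i => h k g i : nat) = set_order (fun i => g i) b k.
  by apply/funext => i; rewrite /set_order ffunE; case: eqVneq.
have hsum (g : {ffun 'I_d -> 'I_N.+1}) :
    (\sum_i h k g i = \sum_i set_order (fun i => g i) b k i)%N.
  by apply: eq_bigr => i _; rewrite /set_order ffunE; case: eqVneq.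
apply: eq_big => j; last by rewrite hupd.
have hb : h k j b == k by rewrite ffunE eqxx.
rewrite hb andbT hupd hsum.
have -> : (h ord0 (h k j) == j) = (j b == 0%N :> nat).
  apply/eqP/eqP => [<-|jb]; first by rewrite !ffunE eqxx.
  apply/ffunP => i; rewrite !ffunE; case: eqVneq => // ->.
  exact/val_inj/esym.
have [jb0|jb0] := eqVneq (j b : nat) 0%N; last first.
  rewrite andbF; apply/esym/negbTE; apply/negP => /andP[_ /supportedP/(_ _ bs) jb].
  by rewrite jb eqxx in jb0.
rewrite sum_set_order// addnA andbT; congr (_ && _).
apply/idP/idP; last exact: supported_set_order.
move=> /supportedP hj; apply/supportedP => i his.
have [->//|ib] := eqVneq i b.
by have := hj i; rewrite mem_rcons inE negb_or ib his /set_order (negbTE ib) => ->.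
Qed.

Lemma multi_sum_nil N M P F :
  (forall t, P t -> (t <= N)%N) -> (forall t, P t -> (t < M)%N) ->
  multi_sum N [::] P F = \sum_(l < M | P l) F l (fun=> 0%N).
Proof.
move=> PN PM; pose G l := if P l then F l (fun=> 0%N) else 0.
rewrite big_mkcond -/(\sum_(l < M) G l) (@sum_ord_vanish M N.+1 G); first last.
- by move=> k kN; rewrite /G; case: ifPn => // /PN; rewrite leqNgt kN.
- by move=> k kM; rewrite /G; case: ifPn => // /PM; rewrite ltnNge kM.
apply: eq_bigr => l _; rewrite /G.
have zE : (fun i : 'I_d => [ffun=> ord0 : 'I_N.+1] i : nat) = fun=> 0%N.
  by apply/funext => i; rewrite ffunE.
rewrite (bigID (pred1 [ffun=> ord0]))/= addrC big1 ?add0r.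
  case: ifPn => Pl; last first.
    rewrite big1// => j /andP[/andP[+ _] /eqP jE]; rewrite jE.
    by rewrite big1 ?addn0 ?(negbTE Pl)// => i _; rewrite ffunE.
  rewrite (big_pred1 [ffun=> ord0]); first by rewrite zE.
  move=> j; rewrite /=; case: eqVneq => [->|]; rewrite ?andbF// andbT zE.
  rewrite big1 ?addn0 ?Pl//; first by apply/supportedP.
  by move=> i _; rewrite ffunE.
move=> j /andP[/andP[_ /supportedP js] /eqP j0]; case: j0.
by apply/ffunP => i; rewrite ffunE; apply: val_inj; exact: js.
Qed.

Lemma multi_sum_enum N P F : multi_sum N (enum 'I_d) P F =
  \sum_(l < N.+1) \sum_(j : {ffun 'I_d -> 'I_N.+1} | P (l + \sum_i j i)%N)
     F l (fun i => j i).
Proof.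
apply: eq_bigr => l _; apply: eq_bigl => j.
by rewrite (_ : supported _ _) ?andbT//; apply/supportedP => i; rewrite mem_enum.
Qed.

End MultiIndex.

Section TaylorMulti.
Variables (R : realType) (d : nat).
Local Notation point := (R * 'rV[R]_d)%type.
Implicit Types (f g : point -> R) (s : seq 'I_d) (j : 'I_d -> nat) (p q z : point).

Definition set_axis p (a : option 'I_d) (t : R) : point :=
  if a is Some i then (p.1, set_coord p.2 i t) else (t, p.2).

Lemma set_axisD p a (t h : R) : set_axis p a (h + t) = h *: axis R a + set_axis p a t.
Proof.
case: a => [i|]; congr pair => /=; rewrite ?scaler0 ?add0r//; last first.
  by rewrite -[_ *: _]/(_ * _) mulr1.
apply/rowP => k; rewrite !mxE eqxx/=.
by case: eqVneq => _; rewrite ?mulr1// mulr0 add0r.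
Qed.

Lemma is_derive_set_axis f p a (t : R) : derivable f (set_axis p a t) (axis R a) ->
  is_derive t 1 (fun t => f (set_axis p a t)) (pderiv1 a f (set_axis p a t)).
Proof.
move=> df.
have e : (fun h => h^-1 *: (((fun t => f (set_axis p a t)) \o shift t) (h *: 1) -
                            f (set_axis p a t))) =
    (fun h => h^-1 *: ((f \o shift (set_axis p a t)) (h *: axis R a) - f (set_axis p a t))).
  by apply/funext => h /=; rewrite -[h *: 1]/(h * 1) mulr1 set_axisD.
by split; rewrite /derivable /derive /pderiv1 e.
Qed.

Lemma cont_diffW m n f : (m <= n)%N -> cont_diff n f -> cont_diff m f.
Proof.
elim: m n f => [|m IH] [|n] f //= mn [cf]; first by [].
by move=> [df D]; split => //; split => // a; exact: IH (D a).
Qed.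

Lemma cont_diff_iter k m a f : cont_diff (m + k) f -> cont_diff m (iter k (pderiv1 a) f).
Proof.
elim: k f => [|k IH] f; first by rewrite addn0.
by rewrite addnS iterSr => -[_ [_ D]]; exact: IH (D a).
Qed.

Lemma cont_diff_continuous n f : cont_diff n f -> continuous f.
Proof. by case: n => [|n] []. Qed.

Lemma derivable_iter k n a f p : (k < n)%N -> cont_diff n f ->
  derivable (iter k (pderiv1 a) f) p (axis R a).
Proof.
move=> kn nf; have := @cont_diff_iter k (n - k) a f; rewrite subnK ?(ltnW kn)//.
by move=> /(_ nf); rewrite -(prednK (n := n - k)) ?subn_gt0// => -[_ []].
Qed.

(** The derivatives met while only the axes of [s] remain to be expanded;
    [pderiv] is the case [s = enum 'I_d]. *)
Definition pderiv_on s l j f : point -> R :=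
  iter l (pderiv1 None) (foldr (fun i g => iter (j i) (pderiv1 (Some i)) g) f s).

Lemma pderiv_on_rcons s b l j k f : b \notin s ->
  pderiv_on (rcons s b) l (set_order j b k) f = pderiv_on s l j (iter k (pderiv1 (Some b)) f).
Proof.
move=> bs; rewrite /pderiv_on foldr_rcons /set_order eqxx; congr (iter l _ _).
elim: s bs => //= i s IH; rewrite inE negb_or eq_sym => /andP[/negbTE ib bs].
by rewrite ib IH.
Qed.

Lemma cont_diff_pderiv m l j f : cont_diff (m + l + \sum_i j i) f ->
  cont_diff m (pderiv l j f).
Proof.
move=> cf; apply: cont_diff_iter; move: cf; rewrite -big_enum/=.
elim: (enum 'I_d) (m + l)%N => [|i s IH] n; first by rewrite big_nil addn0.
by rewrite big_cons addnA => cf; apply: cont_diff_iter; exact: IH.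
Qed.

Definition taylor_monomial p q l j : R :=
  (mfact R l j)^-1 * (p.1 - q.1) ^+ l * \prod_i (p.2 0 i - q.2 0 i) ^+ j i.

(** The box centred at [q] that has [p] as a vertex. *)
Definition in_box p q z := `|z.1 - q.1| <= `|p.1 - q.1| /\
  forall i, `|z.2 0 i - q.2 0 i| <= `|p.2 0 i - q.2 0 i|.

Lemma taylor_monomial_set_order p q l j b k t : j b = 0%N ->
  taylor_monomial p q l (set_order j b k) =
  (p.2 0 b - q.2 0 b) ^+ k / k`!%:R * taylor_monomial (set_axis p (Some b) t) q l j.
Proof.
move=> jb.
have e1 : (\prod_i (set_order j b k i)`! = k`! * \prod_i (j i)`!)%N.
  rewrite (bigD1 b)//= /set_order eqxx; congr (_ * _)%N.
  rewrite [RHS](bigD1 b)//= jb fact0 mul1n.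
  by apply: eq_bigr => i /negbTE ->.
have e2 : \prod_i (p.2 0 i - q.2 0 i) ^+ set_order j b k i = (p.2 0 b - q.2 0 b) ^+ k *
    \prod_i ((set_axis p (Some b) t).2 0 i - q.2 0 i) ^+ j i.
  rewrite (bigD1 b)//= /set_order eqxx; congr (_ * _).
  rewrite [RHS](bigD1 b)//= jb expr0 mul1r.
  by apply: eq_bigr => i /negbTE ib; rewrite mxE ib.
by rewrite /taylor_monomial /mfact e1 e2 mulnCA !natrM !invfM/=; ring.
Qed.

Lemma taylor_monomial0 p q l : taylor_monomial p q l (fun=> 0%N) = (p.1 - q.1) ^+ l / l`!%:R.
Proof.
by rewrite /taylor_monomial /mfact !big1// muln1 mulr1 mulrC.
Qed.

(** The expansion is made one variable at a time, the last axis of [s] first and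
    the x-axis at the end. The derivatives then come out in exactly the order
    of [pderiv], so that neither a chain rule nor the symmetry of mixed
    derivatives is involved. The constants [c] that replace the top-order
    derivatives leave room both for [pderiv l j f q] and for [0]. When [n = 0]
    the points may differ outside [s], because the Lagrange remainder along an
    axis is evaluated at an intermediate coordinate. *)
Lemma taylor_remainder N1 N2 n s f p q (c Om : nat -> ('I_d -> nat) -> R) :
  uniq s -> cont_diff n f -> (n <= N1.+1)%N -> (n <= N2)%N ->
  ((0 < n)%N -> forall i, i \notin s -> p.2 0 i = q.2 0 i) ->
  (forall l j, (l + \sum_i j i)%N = n -> supported s j -> forall z, in_box p q z ->
     `|pderiv_on s l j f z - c l j| <= Om l j) ->
  `|f p - multi_sum N1 s (fun t => t < n)%N
          (fun l j => pderiv_on s l j f q * taylor_monomial p q l j)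
        - multi_sum N2 s (fun t => t == n) (fun l j => c l j * taylor_monomial p q l j)|
  <= multi_sum N2 s (fun t => t == n) (fun l j => Om l j * `|taylor_monomial p q l j|).
Proof.
elim/last_ind: s n f p c Om => [|s b IH] n f p c Om.
  move=> _ nf nN1 nN2 pq hOm.
  have hG k : (k < n)%N -> forall t : R, is_derive t 1
      (fun t => iter k (pderiv1 None) f (set_axis p None t))
      (iter k.+1 (pderiv1 None) f (set_axis p None t)).
    by move=> kn t; apply: is_derive_set_axis; exact: derivable_iter nf.
  have [xi xiq fp] :=
    @taylor_lagrange _ (fun k t => iter k (pderiv1 None) f (set_axis p None t)) n q.1 p.1 hG.
  have {}fp : f p = \sum_(k < n) iter k (pderiv1 None) f (q.1, p.2) * (p.1 - q.1) ^+ k / k`!%:R +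
      iter n (pderiv1 None) f (xi, p.2) * (p.1 - q.1) ^+ n / n`!%:R.
    by move: fp; rewrite /= -surjective_pairing.
  rewrite (multi_sum_nil (M := n)) => [|t tn|t tn]; [|exact: leq_trans tn nN1|by []].
  rewrite !(multi_sum_nil (M := n.+1)); try by move=> t /eqP ->.
  rewrite !(big_pred1 ord_max)//=.
  rewrite taylor_monomial0 fp; set S1 := \sum_(k < n) _; set S2 := \sum_(l < n | _) _.
  have -> : S1 = S2.
    rewrite /S2 big_mkcond/=; apply: eq_bigr => l _.
    have n0 : (0 < n)%N by exact: leq_ltn_trans (ltn_ord l).
    rewrite ltn_ord /pderiv_on/= taylor_monomial0 mulrA.
    have -> // : (q.1, p.2) = q.
    by rewrite [RHS]surjective_pairing; congr pair; apply/rowP => i; exact: pq.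
  have -> : forall a x y z w : R, a + x * y / z - a - w * (y / z) = (x - w) * (y / z).
    by move=> *; ring.
  rewrite normrM ler_wpM2r//; apply: (hOm n (fun=> 0%N)).
  - by rewrite big1 ?addn0.
  - exact/supportedP.
  - by split.
move=> + nf nN1 nN2 pq hOm; rewrite rcons_uniq => /andP[bs us].
have hG k : (k < n)%N -> forall t : R, is_derive t 1
    (fun t => iter k (pderiv1 (Some b)) f (set_axis p (Some b) t))
    (iter k.+1 (pderiv1 (Some b)) f (set_axis p (Some b) t)).
  by move=> kn t; apply: is_derive_set_axis; exact: derivable_iter nf.
have [xi xiq] := taylor_lagrange (q.2 0 b) (p.2 0 b) hG.
have -> : iter 0 (pderiv1 (Some b)) f (set_axis p (Some b) (p.2 0 b)) = f p.
  rewrite /= [in RHS](surjective_pairing p); congr (f (_, _)).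
  by apply/rowP => i; rewrite mxE; case: eqVneq => // ->.
(* The k-th term of the expansion along b lives at the b-coordinate of q,
   except the remainder (k = n), which lives at xi. *)
pose pt k := set_axis p (Some b) (if (k < n)%N then q.2 0 b else xi).
pose w k := (p.2 0 b - q.2 0 b) ^+ k / k`!%:R.
pose g k := iter k (pderiv1 (Some b)) f.
move=> fp; have {}fp : f p = \sum_(k < n.+1) w k * g k (pt k).
  rewrite fp big_ord_recr/=; congr (_ + _).
    by apply: eq_bigr => k _; rewrite /pt ltn_ord -mulrA mulrC.
  by rewrite /pt ltnn -mulrA mulrC.
have box k z : in_box (pt k) q z -> in_box p q z.
  move=> [z1 z2]; split => // i; apply: le_trans (z2 i) _; rewrite mxE.
  case: eqVneq => [->|//]; case: ifP => // _; by rewrite subrr normr0.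
have mE k l j : supported s j ->
    taylor_monomial p q l (set_order j b k) = w k * taylor_monomial (pt k) q l j.
  by move=> /supportedP/(_ b bs) jb; exact: taylor_monomial_set_order.
have addk k t : (k < n.+1)%N -> ((t + k)%N == n) = (t == (n - k)%N).
  by rewrite ltnS => kn; rewrite -{1}(subnK kn) eqn_add2r.
have addk' k t : (k < n.+1)%N -> (t + k < n)%N = (t < n - k)%N.
  by rewrite ltnS => kn; rewrite ltn_subRL addnC.
have lowE : multi_sum N1 (rcons s b) (fun t => t < n)%N
      (fun l j => pderiv_on (rcons s b) l j f q * taylor_monomial p q l j) =
    \sum_(k < n.+1) w k * multi_sum N1 s (fun t => t < n - k)%N
      (fun l j => pderiv_on s l j (g k) q * taylor_monomial (pt k) q l j).
  rewrite (multi_sum_rcons (M := n.+1) _ bs) => [|t tn|t /ltnW//]; last exact: leq_trans tn nN1.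
  apply: eq_bigr => k _; rewrite -multi_sumZ; apply: eq_multi_sum => l j sj; first exact: addk'.
  by move=> _; rewrite pderiv_on_rcons// mE// mulrCA.
have topE (X : nat -> ('I_d -> nat) -> R) : multi_sum N2 (rcons s b) (fun t => t == n)
      (fun l j => X l j * taylor_monomial p q l j) =
    \sum_(k < n.+1) w k * multi_sum N2 s (fun t => t == n - k)%N
      (fun l j => X l (set_order j b k) * taylor_monomial (pt k) q l j).
  rewrite (multi_sum_rcons (M := n.+1) _ bs) => [|t /eqP->//|t /eqP->//].
  apply: eq_bigr => k _; rewrite -multi_sumZ; apply: eq_multi_sum => l j sj; first exact: addk.
  by move=> _; rewrite mE// mulrCA.
have OmE : multi_sum N2 (rcons s b) (fun t => t == n)
      (fun l j => Om l j * `|taylor_monomial p q l j|) =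
    \sum_(k < n.+1) `|w k| * multi_sum N2 s (fun t => t == n - k)%N
      (fun l j => Om l (set_order j b k) * `|taylor_monomial (pt k) q l j|).
  rewrite (multi_sum_rcons (M := n.+1) _ bs) => [|t /eqP->//|t /eqP->//].
  apply: eq_bigr => k _; rewrite -multi_sumZ; apply: eq_multi_sum => l j sj; first exact: addk.
  by move=> _; rewrite mE// normrM mulrCA.
rewrite lowE topE OmE fp -!sumrB; apply: le_trans (ler_norm_sum _ _ _) _.
apply: ler_sum => k _; rewrite -!mulrBr normrM ler_wpM2l//.
have kn : (k <= n)%N by rewrite -ltnS.
apply: IH => //.
- by apply: cont_diff_iter; rewrite subnK.
- exact: leq_trans (leq_subr _ _) nN1.
- exact: leq_trans (leq_subr _ _) nN2.
- rewrite subn_gt0 => k_n i his; rewrite mxE k_n; case: eqVneq => [->//|ib].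
  by apply: pq; [exact: leq_ltn_trans k_n|rewrite mem_rcons inE negb_or ib].
- move=> l j lj sj z zb; rewrite -pderiv_on_rcons//; apply: hOm (box k z zb).
    rewrite sum_set_order ?addnA ?lj ?subnK//; exact: (supportedP _ _ sj).
  exact: supported_set_order.
Qed.

End TaylorMulti.

(** * Reduction to one-dimensional lattice sums *)

Section Continuity.
Variables (R : realType) (T : topologicalType).

Lemma continuous_expr_sub (h : T -> R) (x : R) m :
  continuous h -> continuous (fun q => (x - h q) ^+ m).
Proof.
move=> ch; elim: m => [|m IH]; first by under eq_fun do rewrite expr0; exact: cst_continuous.
under eq_fun do rewrite exprS; move=> q; apply: cvgM; last exact: IH.
by apply: cvgB; [exact: cvg_cst|exact: ch].
Qed.

Lemma continuous_prod_seq (I : Type) (s : seq I) (h : I -> T -> R) :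
  (forall i, continuous (h i)) -> continuous (fun q => \prod_(i <- s) h i q).
Proof.
move=> ch; elim: s => [|i s IH].
  by under eq_fun do rewrite big_nil; exact: cst_continuous.
under eq_fun do rewrite big_cons.
by move=> q; apply: cvgM; [exact: ch|exact: IH].
Qed.

End Continuity.

Section Operator.
Variables (R : realType) (d n : nat) (w : R) (f : R * 'rV[R]_d -> R).
Hypothesis w0 : 0 < w.
Local Notation point := (R * 'rV[R]_d)%type.
Implicit Types (p q : point) (km : int * 'rV[int]_d).

Definition in_cell km q :=
  km.1%:~R / w <= q.1 <= (km.1 + 1)%:~R / w /\
  forall i, (km.2 0 i)%:~R / w <= q.2 0 i <= (km.2 0 i + 1)%:~R / w.

(** [p] is the point of evaluation and [q] the point of expansion, over which the
    operator averages. *)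
Definition taylor_poly p q : R :=
  \sum_(l < n.+1) \sum_(j : {ffun 'I_d -> 'I_n.+1} | (l + \sum_i j i <= n)%N)
    pderiv l (fun i => j i) f q * taylor_monomial p q l (fun i => j i).

(** The coefficient is a mean over the cell, hence it is as close to [y] as the
    averaged function. *)
Lemma le_kantorovich_coef p km (M y : R) :
  (forall l j, (l + \sum_i j i <= n)%N -> continuous (pderiv l j f)) ->
  (forall q, in_cell km q -> `|taylor_poly p q - y| <= M) ->
  `|kantorovich_coef n w f p km.1 km.2 - y| <= M.
Proof.
move=> cf hM; case: km hM => k m hM /=.
set u0 := k%:~R / w; set u1 := (k + 1)%:~R / w.
pose a : 'rV[R]_d := \row_i ((m 0 i)%:~R / w).
pose b : 'rV[R]_d := \row_i ((m 0 i + 1)%:~R / w).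
have step (i : int) : (i + 1)%:~R / w - i%:~R / w = w^-1.
  by rewrite -mulrBl intrD addrAC subrr add0r mul1r.
have wV0 : 0 < w^-1 by rewrite invr_gt0.
have u01 : u0 <= u1 by rewrite -subr_ge0 step ltW.
have ab i : a 0 i <= b 0 i by rewrite !mxE -subr_ge0 step ltW.
have vol : w ^+ d.+1 * cell_volume u0 u1 a b = 1.
  rewrite /cell_volume step (eq_bigr (fun=> w^-1)) => [|i _]; last by rewrite !mxE step.
  by rewrite prodr_const card_ord -exprS exprVn mulfV// expf_neq0// gt_eqF.
pose F l (j : {ffun 'I_d -> 'I_n.+1}) (q : point) :=
  pderiv l (fun i => j i) f q * (p.1 - q.1) ^+ l * \prod_i (p.2 0 i - q.2 0 i) ^+ j i.
have c1 : continuous (fst : point -> R) by move=> q; exact: cvg_fst.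
have c2 i : continuous (fun q : point => q.2 0 i).
  move=> q; apply: (@continuous_comp _ _ _ (snd : point -> _) (fun v => v 0 i)).
    exact: cvg_snd.
  exact: coord_continuous.
have cF l (j : {ffun 'I_d -> 'I_n.+1}) : (l + \sum_i j i <= n)%N -> continuous (F l j).
  move=> lj q; apply: cvgM; last first.
    by apply: continuous_prod_seq => i; exact: continuous_expr_sub.
  by apply: cvgM; [exact: cf|exact: continuous_expr_sub].
pose mf l (j : {ffun 'I_d -> 'I_n.+1}) := (mfact R l (fun i => j i))^-1.
have TE : taylor_poly p = (fun q => \sum_(l < n.+1)
    \sum_(j : {ffun 'I_d -> 'I_n.+1} | (l + \sum_i j i <= n)%N) mf l j * F l j q).
  apply/funext => q; apply: eq_bigr => l _; apply: eq_bigr => j _.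
  by rewrite /taylor_monomial /mf /F; ring.
have cmF l (j : {ffun 'I_d -> 'I_n.+1}) : (l + \sum_i j i <= n)%N ->
    continuous (fun q => mf l j * F l j q).
  by move=> lj q; apply: cvgM; [exact: cvg_cst|exact: cF].
have inner (l : 'I_n.+1) := cell_integral_sum u01 ab
  (index_enum {ffun 'I_d -> 'I_n.+1}) (cmF l).
have [cT IT] := cell_integral_sum u01 ab (index_enum 'I_n.+1)
  (P := predT) (fun l _ => (inner l).1).
have coefE : kantorovich_coef n w f p k m =
    w ^+ d.+1 * cell_integral u0 u1 a b (taylor_poly p).
  rewrite TE IT mulr_sumr; apply: eq_bigr => l _.
  rewrite (inner l).2 mulr_sumr; apply: eq_bigr => j lj.
  by rewrite cell_integralZ//; [rewrite mulrCA|exact: cF].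
have {}cT : continuous (taylor_poly p).
  by rewrite TE.
have cc : continuous (fun _ : point => - y) by exact: cst_continuous.
have -> : kantorovich_coef n w f p k m - y =
    w ^+ d.+1 * cell_integral u0 u1 a b (fun q => taylor_poly p q - y).
  by rewrite cell_integralD// cell_integral_cst// mulrDr -coefE mulrCA vol mulr1.
rewrite normrM (ger0_norm (exprn_ge0 _ (ltW w0))).
rewrite -[leRHS]mulr1 -vol mulrCA ler_wpM2l ?exprn_ge0 ?(ltW w0)//.
apply: le_norm_cell_integral => //.
  by move=> q; apply: cvgB; [exact: cT|exact: cvg_cst].
move=> u v u_in v_in; apply: hM; split => // i.
by have := v_in i; rewrite !mxE.
Qed.


(** The distances, in units of the mesh, from a point to the lower corner of a
    cell. *)
Definition gap0 p km : R := `|w * p.1 - km.1%:~R|.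
Definition gap p km i : R := `|w * p.2 0 i - (km.2 0 i)%:~R|.

Lemma gap0_ge0 p km : 0 <= gap0 p km. Proof. exact: normr_ge0. Qed.
Lemma gap_ge0 p km i : 0 <= gap p km i. Proof. exact: normr_ge0. Qed.

(** A cell has side [1 / w], so passing from its lower corner to one of its
    points changes scaled distances by at most one. *)
Lemma cell_gap (x u : R) (k : int) : k%:~R / w <= u <= (k + 1)%:~R / w ->
  w * `|x - u| <= `|w * x - k%:~R| + 1.
Proof.
rewrite ler_pdivrMr// ler_pdivlMr// intrD => /andP[ku uk].
rewrite -{1}(ger0_norm (ltW w0)) -normrM mulrBr.
have -> : w * x - w * u = (w * x - k%:~R) + (k%:~R - w * u) by ring.
apply: le_trans (ler_normD _ _) _; rewrite lerD2l ler_norml; lra.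
Qed.

Lemma le_norm_taylor_monomial p km q l j : in_cell km q ->
  `|taylor_monomial p q l j| <= (mfact R l j)^-1 * w ^- (l + \sum_i j i) *
    ((gap0 p km + 1) ^+ l * \prod_i (gap p km i + 1) ^+ j i).
Proof.
move=> [q1 q2].
have le1 : `|p.1 - q.1| <= w^-1 * (gap0 p km + 1).
  by rewrite ler_pdivlMl//; exact: cell_gap.
have le2 i : `|p.2 0 i - q.2 0 i| <= w^-1 * (gap p km i + 1).
  by rewrite ler_pdivlMl//; exact: cell_gap.
have mf0 : 0 <= (mfact R l j)^-1 by rewrite invr_ge0 ler0n.
rewrite /taylor_monomial !normrM (ger0_norm mf0) normrX normr_prod -!mulrA ler_wpM2l//.
have -> : w ^- (l + \sum_i j i) * ((gap0 p km + 1) ^+ l *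
    \prod_i (gap p km i + 1) ^+ j i) =
    (w^-1 * (gap0 p km + 1)) ^+ l * \prod_i (w^-1 * (gap p km i + 1)) ^+ j i.
  under [in RHS]eq_bigr do rewrite exprMn.
  rewrite big_split/= prodrXr exprMn -exprVn exprD; ring.
apply: ler_pM => //; first by apply: prodr_ge0.
  by apply: lerXn2r => //; rewrite nnegrE ?(le_trans _ le1).
apply: ler_prod => i _; rewrite normr_ge0/= normrX.
by apply: lerXn2r => //; rewrite nnegrE ?(le_trans _ (le2 i)).
Qed.

End Operator.

Section WeightedSums.
Variable R : realType.
Implicit Types (chi g : R -> R) (u : R).
Local Open Scope ereal_scope.

(** The one-dimensional sums into which the lattice sums of the operator
    factor; the moments bound the case of a power [g]. *)
Definition lattice_sum chi g u : \bar R :=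
  \esum_(k in [set: int]) (`|chi (u - k%:~R)| * g `|u - k%:~R|)%:E.

Lemma lattice_sum_ge0 chi g u : (forall s, (0 <= s)%R -> (0 <= g s)%R) -> 0 <= lattice_sum chi g u.
Proof. by move=> g0; apply: esum_ge0 => k _; rewrite lee_fin mulr_ge0// g0. Qed.

Lemma lattice_sumD chi g1 g2 u : (forall s, (0 <= s)%R -> (0 <= g1 s)%R) ->
  (forall s, (0 <= s)%R -> (0 <= g2 s)%R) ->
  lattice_sum chi (fun s => g1 s + g2 s)%R u = lattice_sum chi g1 u + lattice_sum chi g2 u.
Proof.
move=> g10 g20; rewrite -esumD => [|k _|k _]; rewrite ?lee_fin ?mulr_ge0 ?g10 ?g20//.
by apply: eq_esum => k _; rewrite -EFinD mulrDr.
Qed.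

Lemma lattice_sumZ chi g u (c : R) : (0 <= c)%R -> (forall s, (0 <= s)%R -> (0 <= g s)%R) ->
  lattice_sum chi (fun s => c * g s)%R u = c%:E * lattice_sum chi g u.
Proof.
move=> c0 g0; rewrite -esumZl// => [|k]; last by rewrite lee_fin mulr_ge0 ?g0.
by apply: eq_esum => k _; rewrite -EFinM mulrCA.
Qed.

Lemma le_lattice_sum chi g1 g2 u : (forall s, (0 <= s)%R -> (g1 s <= g2 s)%R) ->
  lattice_sum chi g1 u <= lattice_sum chi g2 u.
Proof. by move=> g12; apply: le_esum => k _; rewrite lee_fin ler_wpM2l// g12. Qed.

Lemma lattice_sum_moment chi l u : lattice_sum chi (fun s => s ^+ l)%R u <= moment chi l%:R.
Proof.
apply: ereal_sup_ge; exists (\esum_(k in [set: int]) moment_term chi l%:R u k).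
  by exists u.
by apply: le_esum => k _; rewrite lee_fin powR_mulrn// mulrC.
Qed.

Lemma moment_ge0 chi b : 0 <= moment chi b.
Proof.
apply: ereal_sup_ge; exists (\esum_(k in [set: int]) moment_term chi b 0 k).
  by exists 0%R.
by apply: esum_ge0 => k _; rewrite lee_fin mulr_ge0// powR_ge0.
Qed.

Lemma prod_ereal_le (I : finType) (x : I -> \bar R) (b : I -> R) :
  (forall i, 0 <= x i) -> (forall i, x i <= (b i)%:E) ->
  \prod_i x i <= (\prod_i b i)%:E.
Proof.
move=> x0 xb.
have xE i : x i = (fine (x i))%:E.
  by rewrite fineK// ge0_fin_numE// (le_lt_trans (xb i))// ltry.
rewrite (eq_bigr (fun i => (fine (x i))%:E)); last by move=> i _; exact: xE.
rewrite prodEFin lee_fin; apply: ler_prod => i _.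
by rewrite fine_ge0//= -lee_fin -xE.
Qed.

End WeightedSums.

Section Estimate.
Variables (R : realType) (d n : nat) (phi : R -> R) (psi : 'I_d -> R -> R).
Hypothesis hphi : sampling_kernel n phi.
Hypothesis hpsi : forall i, sampling_kernel n (psi i).
Local Notation point := (R * 'rV[R]_d)%type.
Implicit Types (p q : point) (km : int * 'rV[int]_d).

Lemma kernel_abs_summable (chi : R -> R) u : sampling_kernel n chi ->
  abs_summable (fun k : int => chi (u - k%:~R)).
Proof.
move=> K; have m0 : (moment chi 0%:R < +oo)%E.
  by apply: (kernel_moment K); rewrite lexx ler0n.
apply: le_lt_trans m0; apply: le_trans (lattice_sum_moment chi 0 u).
by apply: le_esum => k _; rewrite expr0 mulr1.
Qed.

Section Weight.
Variables (w : R) (p : point).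

Definition weight km : R :=
  phi (w * p.1 - km.1%:~R) * \prod_i psi i (w * p.2 0 i - (km.2 0 i)%:~R).

Lemma weight_abs_summable : abs_summable weight.
Proof.
apply: (@abs_summable_prod _ _ _ (fun k : int => phi (w * p.1 - k%:~R))
  (fun m : 'rV[int]_d => \prod_i psi i (w * p.2 0 i - (m 0 i)%:~R))).
  exact: kernel_abs_summable.
apply: (@abs_summable_prod_row _ _ (fun i (k : int) => psi i (w * p.2 0 i - k%:~R))).
by move=> i; exact: kernel_abs_summable.
Qed.

Lemma usum_weight : usum weight = 1.
Proof.
have s1 := kernel_abs_summable (w * p.1) hphi.
have s2 i := kernel_abs_summable (w * p.2 0 i) (hpsi i).
rewrite (usum_prod s1 (abs_summable_prod_row s2)) (kernel_sum1 hphi) mul1r.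
rewrite (@usum_prod_row _ _ (fun i (k : int) => psi i (w * p.2 0 i - k%:~R)) s2).
by apply: big1 => i _; exact: kernel_sum1.
Qed.

Lemma esum_weight_prod (h0 : R -> R) (h : 'I_d -> R -> R) :
  (forall s, 0 <= s -> 0 <= h0 s) -> (forall i s, 0 <= s -> 0 <= h i s) ->
  (forall i, lattice_sum (psi i) (h i) (w * p.2 0%R i) < +oo)%E ->
  (\esum_(km in [set: int * 'rV[int]_d])
     (`|weight km| * (h0 (gap0 w p km) * \prod_i h i (gap w p km i)))%:E =
   lattice_sum phi h0 (w * p.1) * \prod_i lattice_sum (psi i) (h i) (w * p.2 0%R i))%E.
Proof.
move=> h00 h0' hoo.
pose a (k : int) := `|phi (w * p.1 - k%:~R)| * h0 `|w * p.1 - k%:~R|.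
pose b i (k : int) := `|psi i (w * p.2 0 i - k%:~R)| * h i `|w * p.2 0 i - k%:~R|.
have b0 i k : 0 <= b i k by rewrite mulr_ge0// h0'.
have bE := @esum_prod_row _ d b b0 hoo.
rewrite [X in (_ * X)%E](_ : _ = (\prod_i \esum_(k in [set: int]) (b i k)%:E)%E)//.
rewrite -bE -[X in (X * _)%E]/(\esum_(k in [set: int]) (a k)%:E)%E -esum_prod.
- apply: eq_esum => km _; congr EFin; rewrite /weight normrM normr_prod /a /b big_split/=.
  by rewrite /gap0 /gap; ring.
- by move=> k; rewrite mulr_ge0// h00.
- by move=> m; apply: prodr_ge0.
- rewrite bE; have /andP[] // : (0 <= \prod_i (\esum_(k in [set: int]) (b i k)%:E) < +oo)%E.
  apply: prod_ereal_lty => i; apply/andP; split; last exact: hoo.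
  by apply: esum_ge0 => k _; rewrite lee_fin.
Qed.

End Weight.

(** The common shape of all the estimates: the Taylor remainder of order [m] is
    dominated by monomials times a weight [rho] of the gaps, so that the double
    lattice sum factors into one-dimensional sums. *)
Lemma kantorovich_estimate m w (f : point -> R) (om : nat -> ('I_d -> nat) -> R)
    (rho : R -> R) (B0 : nat -> R) (B : 'I_d -> nat -> R) :
  0 < w -> (forall l j, 0 <= om l j) -> (forall s, 0 <= s -> 0 <= rho s) ->
  (forall l j, (l + \sum_i j i <= n)%N -> continuous (pderiv l j f)) ->
  (forall p km q, in_cell w km q -> `|taylor_poly n f p q - f p| <=
     \sum_(l < m.+1) \sum_(j : {ffun 'I_d -> 'I_m.+1} | (l + \sum_i j i == m)%N)
       om l (fun i => j i) * (rho (gap0 w p km) * \prod_i rho (gap w p km i)) *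
       `|taylor_monomial p q l (fun i => j i)|) ->
  (forall l u, (l <= m)%N ->
     (lattice_sum phi (fun s => (s + 1) ^+ l * rho s)%R u <= (B0 l)%:E)%E) ->
  (forall i l u, (l <= m)%N ->
     (lattice_sum (psi i) (fun s => (s + 1) ^+ l * rho s)%R u <= (B i l)%:E)%E) ->
  kantorovich_converges n w phi psi f /\
  forall p, `|kantorovich n w phi psi f p - f p| <=
     \sum_(l < m.+1) \sum_(j : {ffun 'I_d -> 'I_m.+1} | (l + \sum_i j i == m)%N)
       ((mfact R l (fun i => j i))^-1 * w ^- m * om l (fun i => j i)) *
       (B0 l * \prod_i B i (j i)).
Proof.
move=> w0 om0 rho0 cf H HB0 HB.
pose g l s : R := (s + 1) ^+ l * rho s.
have g0 l s : 0 <= s -> 0 <= g l s.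
  by move=> s0; rewrite mulr_ge0 ?rho0// exprn_ge0// addr_ge0.
pose C l (j : {ffun 'I_d -> 'I_m.+1}) :=
  (mfact R l (fun i => j i))^-1 * w ^- m * om l (fun i => j i).
have C0 l j : 0 <= C l j.
  by rewrite mulr_ge0// mulr_ge0// invr_ge0 ?ler0n ?exprn_ge0 ?(ltW w0).
pose S : R := \sum_(l < m.+1) \sum_(j : {ffun 'I_d -> 'I_m.+1} | (l + \sum_i j i == m)%N)
  C l j * (B0 l * \prod_i B i (j i)).
pose G p km : R := \sum_(l < m.+1)
  \sum_(j : {ffun 'I_d -> 'I_m.+1} | (l + \sum_i j i == m)%N)
    C l j * (g l (gap0 w p km) * \prod_i g (j i) (gap w p km i)).
have gg0 l (j : {ffun 'I_d -> 'I_m.+1}) p km :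
    0 <= g l (gap0 w p km) * \prod_i g (j i) (gap w p km i).
  by rewrite mulr_ge0 ?g0 ?gap0_ge0// prodr_ge0// => i _; rewrite g0 ?gap_ge0.
have coefG p km : `|kantorovich_coef n w f p km.1 km.2 - f p| <= G p km.
  apply: le_kantorovich_coef => // q qc; apply: le_trans (H p km q qc) _.
  apply: ler_sum => l _; apply: ler_sum => j /eqP lj.
  set rr := rho _ * _.
  have rr0 : 0 <= rr.
    by rewrite mulr_ge0 ?rho0 ?gap0_ge0// prodr_ge0// => i _; rewrite rho0 ?gap_ge0.
  apply: le_trans (ler_wpM2l _ (le_norm_taylor_monomial w0 p l (fun i => j i) qc)) _.
    by rewrite mulr_ge0.
  rewrite le_eqVlt; apply/orP; left; apply/eqP.
  by rewrite lj /C /g big_split/= /rr; ring.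
have wB0 l : (l <= m)%N -> forall u, (0 <= lattice_sum phi (g l) u <= (B0 l)%:E)%E.
  by move=> lm u; rewrite lattice_sum_ge0 ?HB0// => s; exact: g0.
have wB i l : (l <= m)%N -> forall u, (0 <= lattice_sum (psi i) (g l) u <= (B i l)%:E)%E.
  by move=> lm u; rewrite lattice_sum_ge0 ?HB// => s; exact: g0.
have esumS p : (\esum_(km in [set: int * 'rV[int]_d])
    (`|weight w p km| * G p km)%:E <= S%:E)%E.
  rewrite (_ : (\esum_(km in _) _)%E = (\esum_(km in [set: int * 'rV[int]_d])
      \sum_(l < m.+1) \sum_(j : {ffun 'I_d -> 'I_m.+1} | (l + \sum_i j i == m)%N)
      (C l j)%:E * (`|weight w p km| *
         (g l (gap0 w p km) * \prod_i g (j i) (gap w p km i)))%:E)%E); last first.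
    apply: eq_esum => km _; rewrite /G mulr_sumr -sumEFin; apply: eq_bigr => l _.
    by rewrite mulr_sumr -sumEFin; apply: eq_bigr => j _; rewrite -EFinM mulrCA.
  have T0 l j km : (0 <= (C l j)%:E * (`|weight w p km| *
         (g l (gap0 w p km) * \prod_i g (j i) (gap w p km i)))%:E)%E.
    by rewrite mule_ge0// lee_fin// mulr_ge0.
  rewrite esum_sum => [|km l _ _]; last by apply: sume_ge0 => j _; exact: T0.
  rewrite -sumEFin; apply: lee_sum => l _.
  rewrite esum_sum => [|km j _ _]; last exact: T0.
  rewrite -sumEFin; apply: lee_sum => j _.
  have jm i : (j i <= m)%N by rewrite -ltnS.
  have lm : (l <= m)%N by rewrite -ltnS.
  rewrite esumZl//; last first.
    by move=> km; rewrite lee_fin mulr_ge0.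
  rewrite (@esum_weight_prod w p (g l) (fun i => g (j i))); first last.
  - by move=> i; have /andP[_ /le_lt_trans] := wB i _ (jm i) (w * p.2 0 i); apply; exact: ltry.
  - by move=> i s; exact: g0.
  - by move=> s; exact: g0.
  rewrite [X in (_ <= X)%E]EFinM; apply: lee_wpmul2l; first by rewrite lee_fin.
  rewrite EFinM; apply: lee_pmul.
  - by case/andP: (wB0 _ lm (w * p.1)).
  - by apply: prode_ge0 => i _; case/andP: (wB i _ (jm i) (w * p.2 0 i)).
  - by case/andP: (wB0 _ lm (w * p.1)).
  - by apply: prod_ereal_le => i; case/andP: (wB i _ (jm i) (w * p.2 0 i)).
have fin p : (\esum_(km in [set: int * 'rV[int]_d]) (`|weight w p km| * G p km)%:E < +oo)%E.
  by apply: le_lt_trans (esumS p) _; exact: ltry.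
split=> p; have [sm le_err] := usum_perturb (weight_abs_summable w p) (usum_weight w p)
  (coefG p) (fin p).
  exact: sm.
by rewrite -lee_fin; exact: le_trans le_err (esumS p).
Qed.

End Estimate.

(** * Remainders, moduli of continuity and moments *)

Lemma prodr_ge1 (R : realDomainType) (I : finType) (P : pred I) (F : I -> R) :
  (forall i, P i -> 1 <= F i) -> 1 <= \prod_(i | P i) F i.
Proof. by move=> F1; elim/big_ind: _ => // x y; exact: mulr_ege1. Qed.

Section TaylorPoly.
Variables (R : realType) (d : nat).
Local Notation point := (R * 'rV[R]_d)%type.
Implicit Types (f : point -> R) (p q : point).

Lemma taylor_polyE n f p q : taylor_poly n f p q =
  multi_sum n (enum 'I_d) (fun t => t < n.+1)%N
    (fun l j => pderiv l j f q * taylor_monomial p q l j).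
Proof. by rewrite multi_sum_enum. Qed.

(** For functions of class C^n: the Taylor polynomial contains the terms of
    order [n], so the remainder only sees the variation of the top-order
    derivatives. *)
Lemma taylor_poly_error n f p q (Om : nat -> ('I_d -> nat) -> R) : cont_diff n f ->
  (forall l j, (l + \sum_i j i)%N = n -> forall z, in_box p q z ->
     `|pderiv l j f z - pderiv l j f q| <= Om l j) ->
  `|taylor_poly n f p q - f p| <=
    \sum_(l < n.+1) \sum_(j : {ffun 'I_d -> 'I_n.+1} | (l + \sum_i j i == n)%N)
       Om l (fun i => j i) * `|taylor_monomial p q l (fun i => j i)|.
Proof.
move=> cf hOm; have := @taylor_remainder R d n n n (enum 'I_d) f p q
  (fun l j => pderiv l j f q) Om (enum_uniq _) cf (leqnSn n) (leqnn n).
have agree : (0 < n)%N -> forall i, i \notin enum 'I_d -> p.2 0 i = q.2 0 i.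
  by move=> _ i; rewrite mem_enum.
move=> /(_ agree (fun l j lj _ => hOm l j lj)).
rewrite (multi_sum_enum (R := R) _ (fun t => t == n) (fun l j => Om l j * _)).
apply: le_trans; rewrite distrC -addrA -opprD le_eqVlt; apply/orP; left; apply/eqP.
congr (`|_ - _|).
rewrite taylor_polyE !multi_sum_enum -big_split; apply: eq_bigr => l _ /=.
rewrite big_mkcond [X in _ = X + _]big_mkcond [X in _ = _ + X]big_mkcond -big_split.
apply: eq_bigr => j _ /=; rewrite ltnS leq_eqVlt.
by have [->|] := eqVneq; rewrite ?ltnn ?add0r//=; case: ifP; rewrite ?addr0.
Qed.

(** For functions of class C^(n+1) the expansion is pushed one order further
    than the polynomial, with nothing subtracted at the top order. *)
Lemma taylor_poly_error_next n f p q (Om : nat -> ('I_d -> nat) -> R) :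
  cont_diff n.+1 f ->
  (forall l j, (l + \sum_i j i)%N = n.+1 -> forall z, `|pderiv l j f z| <= Om l j) ->
  `|taylor_poly n f p q - f p| <=
    \sum_(l < n.+2) \sum_(j : {ffun 'I_d -> 'I_n.+2} | (l + \sum_i j i == n.+1)%N)
       Om l (fun i => j i) * `|taylor_monomial p q l (fun i => j i)|.
Proof.
move=> cf hOm; have := @taylor_remainder R d n n.+1 n.+1 (enum 'I_d) f p q
  (fun l j => 0) Om (enum_uniq _) cf (leqnn _) (leqnn _).
have agree : (0 < n.+1)%N -> forall i, i \notin enum 'I_d -> p.2 0 i = q.2 0 i.
  by move=> _ i; rewrite mem_enum.
move=> /(_ agree); rewrite (_ : multi_sum _ _ _ (fun _ _ => 0 * _) = 0); last first.
  by apply: big1 => l _; apply: big1 => j _; rewrite mul0r.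
rewrite subr0 distrC -taylor_polyE multi_sum_enum; apply.
by move=> l j lj _ z _; rewrite subr0; exact: hOm.
Qed.

End TaylorPoly.

Section Modulus.
Variables (R : realType) (d : nat).
Local Notation point := (R * 'rV[R]_d)%type.
Implicit Types (g : point -> R) (p q z : point).

Lemma bounded_fun_le (T : Type) (g : T -> R) : bounded_fun g ->
  \forall C \near +oo, forall x, `|g x| <= C.
Proof. rewrite /= /bounded_near; apply: filterS => C hC x; exact: hC. Qed.

Lemma supnorm_ge0 g : (0 <= supnorm g)%E.
Proof. by apply: ereal_sup_ge; exists (`|g 0|%:E); [exists 0|rewrite lee_fin]. Qed.

Lemma supnorm_le g (C : R) : (forall p, `|g p| <= C) -> (supnorm g <= C%:E)%E.
Proof. by move=> gC; apply: ge_ereal_sup => _ [p _ <-]; rewrite lee_fin. Qed.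

Lemma le_supnorm g p : (`|g p|%:E <= supnorm g)%E.
Proof. by apply: ereal_sup_ubound; exists p. Qed.

Lemma supnorm_fin g (C : R) : (forall p, `|g p| <= C) -> supnorm g \is a fin_num.
Proof.
move=> gC; rewrite ge0_fin_numE ?supnorm_ge0//.
exact: le_lt_trans (supnorm_le gC) (ltry _).
Qed.

Variables (h : R) (h0 : 0 < h).
Notation modh g := (modulus g h (fun=> h)).

Lemma modulus_ge0 g : (0 <= modh g)%E.
Proof.
apply: ereal_sup_ge; exists (`|g 0 - g 0|%:E); last by rewrite lee_fin.
by exists 0, 0; split => //; [rewrite subrr normr0|move=> i; rewrite subrr normr0].
Qed.

Lemma modulus_fin g (C : R) : (forall p, `|g p| <= C) -> modh g \is a fin_num.
Proof.
move=> gC; rewrite ge0_fin_numE ?modulus_ge0//; apply: le_lt_trans (ltry (C + C)).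
apply: ge_ereal_sup => _ [p [q [_ _ ->]]]; rewrite lee_fin.
by apply: le_trans (ler_normB _ _) _; rewrite lerD.
Qed.

(** Two points are joined by [N] steps of mesh less than [h] as soon as [N]
    exceeds all coordinate distances counted in units of [h]; the integer part
    of the product of the [1 + distance / h] is such an [N]. *)
Lemma modulus_chain g z q : modh g \is a fin_num ->
  `|g z - g q| <= fine (modh g) *
    ((1 + `|z.1 - q.1| / h) * \prod_i (1 + `|z.2 0 i - q.2 0 i| / h)).
Proof.
move=> mfin; set P := (X in _ * X).
pose t0 := `|z.1 - q.1| / h; pose t i := `|z.2 0 i - q.2 0 i| / h.
have t00 : 0 <= t0 by rewrite divr_ge0// ltW.
have ti0 i : 0 <= t i by rewrite divr_ge0// ltW.
have P1 : 1 <= \prod_i (1 + t i).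
  by apply: prodr_ge1 => i _; rewrite lerDl.
have Pt0 : 1 + t0 <= P by rewrite ler_peMr// addr_ge0.
have Pti i : 1 + t i <= P.
  rewrite /P (bigD1 i)//= mulrCA ler_peMr ?addr_ge0//.
  apply: mulr_ege1; first by rewrite lerDl.
  by apply: prodr_ge1 => k _; rewrite lerDl; exact: ti0.
have P0 : 0 <= P by apply: le_trans Pt0; rewrite addr_ge0.
pose N := Num.truncn P.
have [NP PN] : N%:R <= P /\ P < N.+1%:R by apply/andP; exact: truncn_itv.
have Nt (x : R) : 1 + x <= P -> x < N%:R.
  by move=> xP; rewrite -(ltrD2r 1) natr1 addrC; exact: le_lt_trans PN.
have N0 : 0 < N%:R :> R by apply: le_lt_trans (Nt _ Pt0).
have step p1 p2 : `|p1.1 - p2.1| < h -> (forall i, `|p1.2 0 i - p2.2 0 i| < h) ->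
    `|g p1 - g p2| <= fine (modh g).
  move=> c1 c2; rewrite -lee_fin fineK//; apply: ereal_sup_ubound.
  by exists p1, p2.
pose pt k : point := (q.1 + k%:R / N%:R * (z.1 - q.1),
                      q.2 + (k%:R / N%:R) *: (z.2 - q.2)).
have diff (k : nat) (a b : R) : `|b - a| / h < N%:R ->
    `|(a + k.+1%:R / N%:R * (b - a)) - (a + k%:R / N%:R * (b - a))| < h.
  rewrite ltr_pdivrMr// => lt.
  have -> : (a + k.+1%:R / N%:R * (b - a)) - (a + k%:R / N%:R * (b - a)) = (b - a) / N%:R.
    by rewrite -natr1; ring.
  by rewrite normrM normfV (gtr0_norm N0) ltr_pdivrMr// mulrC.
have chain k : `|g (pt k) - g q| <= k%:R * fine (modh g).
  elim: k => [|k IH].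
    have -> : pt 0 = q.
      by rewrite /pt !mul0r scale0r !addr0 -surjective_pairing.
    by rewrite subrr normr0 mul0r.
  rewrite -[g _ - g q](subrKA (g (pt k))); apply: le_trans (ler_normD _ _) _.
  rewrite -natr1 mulrDl mul1r addrC lerD//; apply: step => [|i].
    by apply: diff; exact: Nt.
  by rewrite !mxE; apply: diff; exact: Nt (Pti i).
have ptN : pt N = z.
  rewrite /pt divff ?gt_eqF// mul1r scale1r [in RHS](surjective_pairing z).
  by congr pair; rewrite addrC subrK.
have := chain N; rewrite ptN => /le_trans; apply.
rewrite mulrC ler_wpM2l//; exact/fine_ge0/modulus_ge0.
Qed.

Lemma BUC_uniform g : BUC g -> forall eps : R, 0 < eps ->
  \forall del \near 0^'+, forall p q, `|p.1 - q.1| < del ->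
    (forall i, `|p.2 0 i - q.2 0 i| < del) -> `|g p - g q| < eps.
Proof.
move=> [/unif_continuousP ug _] eps eps0; have [del del0 hd] := ug _ eps0.
near=> e => p q c1 c2; have ed : e < del by near: e; exact: nbhs_right_lt.
have := hd (p, q); apply; split => /=; first exact: lt_trans ed.
split=> // i j; rewrite (ord1 i); exact: lt_trans ed.
Unshelve. all: by end_near. Qed.

End Modulus.

Section MomentBounds.
Variable R : realType.
Implicit Types (chi : R -> R) (s u : R).

(** After division by [2 ^+ l] this is convexity of the power; the induction step is
    Chebyshev's inequality [(s ^+ l - 1) * (s - 1) >= 0]. At [l = 0] it is an
    equality, with [s ^+ 0 = 1]. *)
Lemma expr_add1_le s l : 0 <= s -> (s + 1) ^+ l <= 2 ^+ l / 2 * (s ^+ l + 1).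
Proof.
move=> s0; suff : 2 * (s + 1) ^+ l <= 2 ^+ l * (s ^+ l + 1) by lra.
elim: l => [|l IH]; first by rewrite !expr0; lra.
have cheb : 0 <= (s ^+ l - 1) * (s - 1).
  have [s1|/ltW s1] := leP 1 s.
    by rewrite mulr_ge0// subr_ge0// exprn_ege1.
  by rewrite mulr_le0// subr_le0// exprn_ile1.
have s10 : 0 <= s + 1 by lra.
have := ler_wpM2r s10 IH; rewrite ![_ ^+ l.+1]exprS.
have := ler_wpM2l (exprn_ge0 l (ler0n R 2)) cheb; rewrite mulr0.
lra.
Qed.

Definition moment_value chi (b : R) : R := fine (moment chi b).

Lemma moment_valueE chi b : (moment chi b < +oo)%E -> moment chi b = (moment_value chi b)%:E.
Proof. by move=> m; rewrite fineK// ge0_fin_numE// moment_ge0. Qed.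

Lemma lattice_sum_expr_add1 chi l u : (moment chi l%:R < +oo)%E -> (moment chi 0%R < +oo)%E ->
  (lattice_sum chi (fun s => (s + 1) ^+ l * 1)%R u <=
   (2 ^+ l / 2 * (moment_value chi l%:R + moment_value chi 0))%:E)%E.
Proof.
move=> ml m0.
apply: (@le_trans _ _ (lattice_sum chi (fun s => 2 ^+ l / 2 * (s ^+ l + s ^+ 0))%R u)).
  by apply: le_lattice_sum => s s0; rewrite mulr1 expr0; exact: expr_add1_le.
rewrite lattice_sumZ; first last.
- by move=> s s0; rewrite addr_ge0 ?exprn_ge0.
- by rewrite divr_ge0 ?exprn_ge0.
rewrite [X in (_ <= X)%E]EFinM; apply: lee_wpmul2l; first by rewrite lee_fin divr_ge0 ?exprn_ge0.
rewrite lattice_sumD; [|by move=> s s0; rewrite exprn_ge0..].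
rewrite EFinD -moment_valueE// -moment_valueE//; apply: leeD; exact: lattice_sum_moment.
Qed.

Lemma lattice_sum_expr_add1_add2 chi l u :
  (moment chi l.+1%:R < +oo)%E -> (moment chi l%:R < +oo)%E ->
  (moment chi 1%R < +oo)%E -> (moment chi 0%R < +oo)%E ->
  (lattice_sum chi (fun s => (s + 1) ^+ l * (s + 2))%R u <=
   (2 ^+ l / 2 * (moment_value chi l.+1%:R + 2 * moment_value chi l%:R +
                  moment_value chi 1 + 2 * moment_value chi 0))%:E)%E.
Proof.
move=> ml1 ml m1 m0.
apply: (@le_trans _ _ (lattice_sum chi (fun s => 2 ^+ l / 2 *
    (s ^+ l.+1 + 2 * s ^+ l + s ^+ 1 + 2 * s ^+ 0))%R u)).
  apply: le_lattice_sum => s s0.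
  have -> : s ^+ l.+1 + 2 * s ^+ l + s ^+ 1 + 2 * s ^+ 0 = (s ^+ l + 1) * (s + 2).
    by rewrite exprS expr1 expr0; ring.
  rewrite mulrA ler_wpM2r ?addr_ge0//; exact: expr_add1_le.
have e0 k s : 0 <= s -> 0 <= s ^+ k by move=> s0; rewrite exprn_ge0.
have e20 k s : 0 <= s -> 0 <= 2 * s ^+ k by move=> s0; rewrite mulr_ge0 ?exprn_ge0.
rewrite lattice_sumZ; first last.
- by move=> s s0; rewrite !addr_ge0 ?e0 ?e20.
- by rewrite divr_ge0 ?exprn_ge0.
rewrite [X in (_ <= X)%E]EFinM; apply: lee_wpmul2l; first by rewrite lee_fin divr_ge0 ?exprn_ge0.
rewrite lattice_sumD; first last;
  [by move=> s; exact: e20|by move=> s s0; rewrite !addr_ge0 ?e0 ?e20|].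
rewrite lattice_sumD; first last;
  [by move=> s; exact: e0|by move=> s s0; rewrite !addr_ge0 ?e0 ?e20|].
rewrite lattice_sumD; first last;
  [by move=> s; exact: e20|by move=> s; exact: e0|].
rewrite !lattice_sumZ//; [|by move=> s; exact: e0..].
rewrite !EFinD !EFinM -!moment_valueE//.
by rewrite !leeD// ?lee_wpmul2l ?lee_fin//; exact: lattice_sum_moment.
Qed.

Definition moment_tail n chi (r : R) : \bar R := ereal_sup (range (fun u =>
  \esum_(k in [set k : int | r <= `|u - k%:~R|]) moment_term chi n%:R u k)).

Lemma lattice_sum_tail n chi r u :
  (lattice_sum chi (fun s => s ^+ n * (r <= s)%R%:R)%R u <= moment_tail n chi r)%E.
Proof.
apply: ereal_sup_ge; eexists; first by exists u.
rewrite [X in (_ <= X)%E]esum_mkcond; apply: le_esum => k _.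
rewrite /moment_term powR_mulrn// mulrA -[_ * _ ^+ n]mulrC.
case: ifPn; rewrite ?inE ?notin_setE /= => rk; first by rewrite rk mulr1.
by rewrite (negbTE (introN idP rk)) mulr0.
Qed.

Lemma lattice_sum_expr_add1_tail n chi l (kap tau r u : R) : (l <= n)%N ->
  (moment chi l%:R < +oo)%E -> (moment chi 0%R < +oo)%E ->
  0 <= kap -> 1 <= r -> (moment_tail n chi r <= tau%:E)%E -> kap * 2 ^+ n * tau <= 1 ->
  (lattice_sum chi (fun s => (s + 1) ^+ l * (1 + kap * (r <= s)%R%:R))%R u <=
   (2 ^+ l / 2 * (moment_value chi l%:R + moment_value chi 0) + 1)%:E)%E.
Proof.
move=> ln ml m0 kap0 r1 tr kt.
have k20 : 0 <= kap * 2 ^+ n by rewrite mulr_ge0 ?exprn_ge0.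
apply: (@le_trans _ _ (lattice_sum chi (fun s => (s + 1) ^+ l * 1 +
    kap * 2 ^+ n * (s ^+ n * (r <= s)%R%:R))%R u)).
  apply: le_lattice_sum => s s0; rewrite mulrDr lerD2l mulrCA -mulrA ler_wpM2l//.
  have [rs|rs] := leP r s; last by rewrite !mulr0.
  rewrite !mulr1.
  have s1 : 1 <= s by exact: le_trans rs.
  apply: (@le_trans _ _ ((2 * s) ^+ l)).
    by apply: lerXn2r; rewrite ?nnegrE; lra.
  by rewrite -exprMn; apply: ler_weXn2l => //; lra.
have pos1 s : 0 <= s -> 0 <= (s + 1) ^+ l * 1.
  by move=> s0; rewrite mulr1 exprn_ge0// addr_ge0.
have pos2 s : 0 <= s -> 0 <= s ^+ n * (r <= s)%R%:R.
  by move=> s0; rewrite mulr_ge0 ?exprn_ge0.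
rewrite lattice_sumD//; last by move=> s s0; rewrite mulr_ge0 ?pos2.
rewrite EFinD; apply: leeD; first exact: lattice_sum_expr_add1.
rewrite lattice_sumZ//; apply: (@le_trans _ _ ((kap * 2 ^+ n)%:E * tau%:E)%E).
  by rewrite lee_wpmul2l ?lee_fin//; apply: le_trans (lattice_sum_tail _ _ _ _) tr.
by rewrite -EFinM lee_fin.
Qed.

End MomentBounds.

(** * The three estimates *)

Section Main.
Variables (R : realType) (d n : nat) (phi : R -> R) (psi : 'I_d -> R -> R).
Hypothesis hphi : sampling_kernel n phi.
Hypothesis hpsi : forall i, sampling_kernel n (psi i).
Local Notation point := (R * 'rV[R]_d)%type.
Implicit Types (f : point -> R) (p q z : point) (km : int * 'rV[int]_d).

(** There are finitely many multi-indices of weight [n], so eventual properties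
    of each hold eventually for all of them. *)
Lemma near_multi_index (T : Type) (F : set_system T) (P : nat -> ('I_d -> nat) -> set T) :
  Filter F -> (forall l j, (l + \sum_i j i)%N = n -> \forall x \near F, P l j x) ->
  \forall x \near F, forall l j, (l + \sum_i j i)%N = n -> P l j x.
Proof.
move=> FF hP.
have := @filter_forall T ('I_n.+1 * {ffun 'I_d -> 'I_n.+1})%type
  (fun lj x => (lj.1 + \sum_i lj.2 i)%N = n -> P lj.1 (fun i => lj.2 i) x) F FF.
have hf (lj : 'I_n.+1 * {ffun 'I_d -> 'I_n.+1}) :
    \forall x \near F, (lj.1 + \sum_i lj.2 i)%N = n -> P lj.1 (fun i => lj.2 i) x.
  have [e|ne] := pselect ((lj.1 + \sum_i lj.2 i)%N = n); last by near=> x.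
  by apply: filterS (hP _ _ e) => x + _; apply.
move=> /(_ hf); apply: filterS => x hx l j lj.
have ln : (l < n.+1)%N by rewrite ltnS -lj leq_addr.
have jn i : (j i < n.+1)%N.
  by rewrite ltnS -lj (bigD1 i)//= addnCA leq_addr.
have := hx (Ordinal ln, [ffun i => Ordinal (jn i)]) => /=.
rewrite (_ : (fun i => _) = j); last by apply/funext => i; rewrite ffunE.
by apply; rewrite -[RHS]lj; congr (_ + _)%N; apply: eq_bigr => i _; rewrite ffunE.
Unshelve. all: by end_near. Qed.

Lemma kernel_moment_fin (chi : R -> R) l : sampling_kernel n chi -> (l <= n)%N ->
  (moment chi l%:R < +oo)%E.
Proof. by move=> K ln; apply: (kernel_moment K); rewrite ler0n ler_nat. Qed.

Lemma kernel_moment_fin_next (chi : R -> R) l : sampling_kernel n chi ->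
  (moment chi n.+1%:R < +oo)%E -> (l <= n.+1)%N -> (moment chi l%:R < +oo)%E.
Proof.
by move=> K mn; rewrite leq_eqVlt => /predU1P[->//|]; exact: kernel_moment_fin.
Qed.

Lemma class_C_continuous f : cont_diff n f ->
  forall l j, (l + \sum_i j i <= n)%N -> continuous (pderiv l j f).
Proof.
move=> cf l j lj; apply: (@cont_diff_continuous _ _ 0).
by apply: cont_diff_pderiv; exact: cont_diffW cf.
Qed.

Lemma class_C_bounded f : class_C n f ->
  exists2 C, 0 <= C & forall l j, (l + \sum_i j i)%N = n ->
    forall p, `|pderiv l j f p| <= C.
Proof.
move=> [_ hB].
have h : \forall C \near +oo, forall l j, (l + \sum_i j i)%N = n ->
    forall p, `|pderiv l j f p| <= C.
  by apply: near_multi_index => l j lj; apply: bounded_fun_le; exact: (hB l j lj).2.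
have h0 : \forall C \near +oo, 0 <= C :> R by exact: nbhs_pinfty_ge.
by have [C [C0 hC]] := filter_ex (filterI h0 h); exists C.
Qed.

Lemma class_C_uniform f : class_C n f -> forall eps : R, 0 < eps ->
  exists2 del, 0 < del & forall l j, (l + \sum_i j i)%N = n ->
    forall p q, `|p.1 - q.1| < del -> (forall i, `|p.2 0 i - q.2 0 i| < del) ->
    `|pderiv l j f p - pderiv l j f q| < eps.
Proof.
move=> [_ hB] eps eps0.
have h : \forall del \near 0^'+, forall l j, (l + \sum_i j i)%N = n ->
    forall p q, `|p.1 - q.1| < del -> (forall i, `|p.2 0 i - q.2 0 i| < del) ->
    `|pderiv l j f p - pderiv l j f q| < eps.
  by apply: near_multi_index => l j lj; apply: BUC_uniform => //; exact: hB.
have h0 : \forall del \near 0^'+, 0 < del :> R by exact: nbhs_right_gt.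
near (0 : R)^'+ => del.
by exists del; near: del.
Unshelve. all: by end_near. Qed.

Lemma class_C_converges f w : class_C n f -> 0 < w ->
  kantorovich_converges n w phi psi f.
Proof.
move=> cf w0; have [C C0 hC] := class_C_bounded cf.
have wB (chi : R -> R) l u : sampling_kernel n chi -> (l <= n)%N ->
    (lattice_sum chi (fun s => (s + 1) ^+ l * 1)%R u <=
     (2 ^+ l / 2 * (moment_value chi l%:R + moment_value chi 0))%:E)%E.
  move=> K ln; apply: lattice_sum_expr_add1; first exact: kernel_moment_fin.
  exact: (kernel_moment_fin K (leq0n n)).
have H p km q : in_cell w km q -> `|taylor_poly n f p q - f p| <=
     \sum_(l < n.+1) \sum_(j : {ffun 'I_d -> 'I_n.+1} | (l + \sum_i j i == n)%N)
       (C + C) * (1 * \prod_(i < d) 1) * `|taylor_monomial p q l (fun i => j i)|.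
  have p1 : \prod_(i < d) 1 = 1 :> R by rewrite big1.
  move=> qc; apply: (taylor_poly_error (Om := fun _ _ => (C + C) * (1 * \prod_(i < d) 1))).
    exact: cf.1.
  move=> l j lj z _; rewrite p1 !mulr1; apply: le_trans (ler_normB _ _) _.
  by rewrite lerD ?hC.
exact: (kantorovich_estimate (om := fun _ _ => C + C) (rho := fun=> 1) hphi hpsi w0
  (fun _ _ => addr_ge0 C0 C0) (fun _ _ => ler01) (class_C_continuous cf.1) H
  (fun l u ln => wB _ l u hphi ln) (fun i l u ln => wB _ l u (hpsi i) ln)).1.
Qed.

Lemma pow2_exprz k : (2 : R) ^ (n%:Z - k%:Z) = 2 ^+ n / 2 ^+ k.
Proof. by rewrite expfzDr ?pnatr_eq0// exprnN. Qed.

Lemma prod_pow2 (I : finType) (a : I -> nat) (X : I -> R) :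
  \prod_i (2 ^+ a i / 2 * X i) = 2 ^+ (\sum_i a i) / 2 ^+ #|I| * \prod_i X i.
Proof.
by rewrite big_split/= big_split/= prodr_const prodrXr exprVn.
Qed.

Lemma cell_box_gap w p km q z : 0 < w -> in_cell w km q -> in_box p q z ->
  w * `|z.1 - q.1| <= gap0 w p km + 1 /\
  forall i, w * `|z.2 0 i - q.2 0 i| <= gap w p km i + 1.
Proof.
move=> w0 [q1 q2] [z1 z2]; split=> [|i].
  by apply: le_trans (cell_gap w0 _ q1); rewrite ler_pM2l.
by apply: le_trans (cell_gap w0 _ (q2 i)); rewrite ler_pM2l.
Qed.

(** The constants come from [(s + 2) * (s ^+ l + 1)] expanded into moments, and
    from one factor [2 ^+ (l - 1)] per axis, of product [2 ^ (n - (d + 1))]. *)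
Lemma class_C_modulus_estimate f w p : class_C n f ->
  (moment phi n.+1%:R < +oo)%E -> (forall i, (moment (psi i) n.+1%:R < +oo)%E) ->
  0 < w ->
  `|kantorovich n w phi psi f p - f p| <=
  2 ^ (n%:Z - d.+1%:Z) / w ^+ n *
  \sum_(l < n.+1) \sum_(j : {ffun 'I_d -> 'I_n.+1} | (l + \sum_i j i == n)%N)
    ((mfact R l (fun i => j i))^-1 *
     fine (modulus (pderiv l (fun i => j i) f) w^-1 (fun=> w^-1)) *
     (moment_value phi l.+1%:R + 2 * moment_value phi l%:R +
      moment_value phi 1 + 2 * moment_value phi 0) *
     \prod_i (moment_value (psi i) (j i).+1%:R + 2 * moment_value (psi i) (j i)%:R +
              moment_value (psi i) 1 + 2 * moment_value (psi i) 0)).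
Proof.
move=> cf mphi mpsi w0; have [C C0 hC] := class_C_bounded cf.
have wV0 : 0 < w^-1 by rewrite invr_gt0.
pose om l j := fine (modulus (pderiv l j f) w^-1 (fun=> w^-1)).
pose X (chi : R -> R) l := moment_value chi l.+1%:R + 2 * moment_value chi l%:R +
  moment_value chi 1 + 2 * moment_value chi 0.
have wX chi l u : sampling_kernel n chi -> (moment chi n.+1%:R < +oo)%E -> (l <= n)%N ->
    (lattice_sum chi (fun s => (s + 1) ^+ l * (s + 2))%R u <= (2 ^+ l / 2 * X chi l)%:E)%E.
  move=> K mn ln; have fin k := @kernel_moment_fin_next chi k K mn.
  apply: lattice_sum_expr_add1_add2; [exact: fin|exact/fin/leqW|exact: (fin 1%N)|exact: (fin 0%N)].
have H p' km q : in_cell w km q -> `|taylor_poly n f p' q - f p'| <=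
     \sum_(l < n.+1) \sum_(j : {ffun 'I_d -> 'I_n.+1} | (l + \sum_i j i == n)%N)
       om l (fun i => j i) * ((gap0 w p' km + 2) * \prod_i (gap w p' km i + 2)) *
       `|taylor_monomial p' q l (fun i => j i)|.
  move=> qc; apply: (taylor_poly_error (Om := fun l j => om l j *
    ((gap0 w p' km + 2) * \prod_i (gap w p' km i + 2)))); first exact: cf.1.
  move=> l j lj z zb; have [b1 b2] := cell_box_gap w0 qc zb.
  have mfin := modulus_fin wV0 (hC l j lj).
  apply: le_trans (modulus_chain wV0 z q mfin) _.
  rewrite ler_wpM2l ?fine_ge0 ?modulus_ge0//.
  have le2 (x y : R) : w * x <= y + 1 -> 1 + x / w^-1 <= y + 2.
    by rewrite invrK [x * w]mulrC; lra.
  apply: ler_pM.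
  + by rewrite addr_ge0// divr_ge0// ltW.
  + by apply: prodr_ge0 => i _; rewrite addr_ge0// divr_ge0// ltW.
  + exact: le2.
  + apply: ler_prod => i _; rewrite le2//= andbT.
    by rewrite addr_ge0// divr_ge0// ltW.
have [_ /(_ p)] := kantorovich_estimate (om := om) (rho := fun s => s + 2) hphi hpsi w0
  (fun l j => fine_ge0 (modulus_ge0 wV0 _)) (fun s s0 => addr_ge0 s0 (ler0n R 2))
  (class_C_continuous cf.1) H (fun l u ln => wX phi l u hphi mphi ln)
  (fun i l u ln => wX (psi i) l u (hpsi i) (mpsi i) ln).
move=> /le_trans; apply; rewrite le_eqVlt; apply/orP; left; apply/eqP.
rewrite mulr_sumr; apply: eq_bigr => l _; rewrite mulr_sumr; apply: eq_bigr => j /eqP lj.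
have e2 : 2 ^+ n = 2 ^+ l * 2 ^+ (\sum_i j i) :> R by rewrite -exprD lj.
by rewrite prod_pow2 card_ord pow2_exprz e2 exprS [(2 * _)^-1]invfM /om /X; ring.
Qed.

(** Here the orders of the multi-index add up to [n + 1], which turns the factors
    [2 ^+ (l - 1)] of the [d + 1] axes into [2 ^ (n - d)]. *)
Lemma class_Cb_estimate f w : class_Cb n.+1 f ->
  (moment phi n.+1%:R < +oo)%E -> (forall i, (moment (psi i) n.+1%:R < +oo)%E) ->
  0 < w ->
  kantorovich_converges n w phi psi f /\ forall p,
  `|kantorovich n w phi psi f p - f p| <=
  2 ^ (n%:Z - d%:Z) / w ^+ n.+1 *
  \sum_(l < n.+2) \sum_(j : {ffun 'I_d -> 'I_n.+2} | (l + \sum_i j i == n.+1)%N)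
    ((mfact R l (fun i => j i))^-1 * fine (supnorm (pderiv l (fun i => j i) f)) *
     (moment_value phi l%:R + moment_value phi 0) *
     \prod_i (moment_value (psi i) (j i)%:R + moment_value (psi i) 0)).
Proof.
move=> [cf hb] mphi mpsi w0.
pose om l j := fine (supnorm (pderiv l j f)).
pose X (chi : R -> R) l := moment_value chi l%:R + moment_value chi 0.
have cont l j : (l + \sum_i j i <= n)%N -> continuous (pderiv l j f).
  by move=> lj; exact: (hb l j (leqW lj)).1.
have le_om l j : (l + \sum_i j i)%N = n.+1 -> forall z, `|pderiv l j f z| <= om l j.
  move=> lj z; have [_ bf] := hb l j (eq_leq lj).
  have [C hC] := filter_ex (bounded_fun_le bf).
  by rewrite -lee_fin fineK ?(supnorm_fin hC)//; exact: le_supnorm.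
have wX chi l u : sampling_kernel n chi -> (moment chi n.+1%:R < +oo)%E -> (l <= n.+1)%N ->
    (lattice_sum chi (fun s => (s + 1) ^+ l * 1)%R u <= (2 ^+ l / 2 * X chi l)%:E)%E.
  move=> K mn ln; have fin k := @kernel_moment_fin_next chi k K mn.
  by apply: lattice_sum_expr_add1; [exact: fin|exact: (fin 0%N)].
have H p km q : in_cell w km q -> `|taylor_poly n f p q - f p| <=
     \sum_(l < n.+2) \sum_(j : {ffun 'I_d -> 'I_n.+2} | (l + \sum_i j i == n.+1)%N)
       om l (fun i => j i) * (1 * \prod_(i < d) 1) * `|taylor_monomial p q l (fun i => j i)|.
  have p1 : \prod_(i < d) 1 = 1 :> R by rewrite big1.
  move=> _; apply: (@taylor_poly_error_next _ _ _ _ _ _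
    (fun l j => om l j * (1 * \prod_(i < d) 1))).
    exact: cf.
  by move=> l j lj z; rewrite p1 !mulr1; exact: le_om.
have [conv est] := kantorovich_estimate (om := om) (rho := fun=> 1) hphi hpsi w0
  (fun l j => fine_ge0 (supnorm_ge0 _)) (fun _ _ => ler01) cont H
  (fun l u ln => wX phi l u hphi mphi ln)
  (fun i l u ln => wX (psi i) l u (hpsi i) (mpsi i) ln).
split=> // p; apply: le_trans (est p) _; rewrite le_eqVlt; apply/orP; left; apply/eqP.
rewrite mulr_sumr; apply: eq_bigr => l _; rewrite mulr_sumr; apply: eq_bigr => j /eqP lj.
have e2 : 2 ^+ n = 2 ^+ l * 2 ^+ (\sum_i j i) / 2 :> R.
  by rewrite -exprD lj exprS mulrAC divff ?mul1r// pnatr_eq0.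
by rewrite prod_pow2 card_ord pow2_exprz e2 /om /X; ring.
Qed.

Lemma tail_small chi (tau : R) : sampling_kernel n chi -> 0 < tau ->
  \forall r \near +oo, (moment_tail n chi r < tau%:E)%E.
Proof.
move=> K tau0; have /(_ [set y | (y < tau%:E)%E]) := kernel_tail K; apply.
by apply: open_nbhs_nbhs; split; [exact: open_ereal_lt_ereal|rewrite /= lte_fin].
Qed.

Lemma moment_value_ge0 (chi : R -> R) b : 0 <= moment_value chi b.
Proof. exact/fine_ge0/moment_ge0. Qed.

(** Where all gaps are smaller than [r] uniform continuity gives [eps]; elsewhere
    the factor [1 + kap] of one of the gaps compensates the crude bound [C + C],
    and the tail condition makes this factor affordable. *)
Lemma class_C_small f : class_C n f -> forall e : R, 0 < e ->
  \forall w \near +oo, forall p, `|kantorovich n w phi psi f p - f p| <= e * w ^- n.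
Proof.
move=> cf e e0; have [C C0 hC] := class_C_bounded cf.
pose B (chi : R -> R) l : R := 2 ^+ l / 2 * (moment_value chi l%:R + moment_value chi 0) + 1.
have B0 chi l : 0 <= B chi l.
  by rewrite addr_ge0// mulr_ge0 ?divr_ge0 ?exprn_ge0// addr_ge0 ?moment_value_ge0.
(* D bounds the lattice sums uniformly in w; eps is the fraction of e that
   absorbs it, and kap makes eps * (1 + kap) exceed the crude bound C + C. *)
pose D : R := \sum_(l < n.+1) \sum_(j : {ffun 'I_d -> 'I_n.+1} | (l + \sum_i j i == n)%N)
  (mfact R l (fun i => j i))^-1 * (B phi l * \prod_i B (psi i) (j i)).
have D0 : 0 <= D.
  apply: sumr_ge0 => l _; apply: sumr_ge0 => j _.
  by rewrite mulr_ge0 ?invr_ge0 ?ler0n// mulr_ge0// prodr_ge0.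
have D10 : 0 < D + 1 by rewrite ltr_wpDl.
pose eps := e / (D + 1); have eps0 : 0 < eps by rewrite divr_gt0.
pose kap := (C + C) / eps.
have kap0 : 0 <= kap by rewrite divr_ge0 ?addr_ge0// ltW.
have k2 : 0 <= kap * 2 ^+ n by rewrite mulr_ge0 ?exprn_ge0.
pose tau := (kap * 2 ^+ n + 1)^-1.
have tau0 : 0 < tau by rewrite invr_gt0 ltr_wpDl.
have ktau : kap * 2 ^+ n * tau <= 1.
  by rewrite ler_pdivrMr ?ltr_wpDl// mul1r lerDl.
have [r [r1 [rphi rpsi]]] : exists r : R, 1 <= r /\ (moment_tail n phi r < tau%:E)%E /\
    forall i, (moment_tail n (psi i) r < tau%:E)%E.
  have h1 : \forall r \near +oo, 1 <= r :> R by exact: nbhs_pinfty_ge.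
  have h2 := tail_small hphi tau0.
  have h3 : \forall r \near +oo, forall i, (moment_tail n (psi i) r < tau%:E)%E.
    by apply: filter_forall => i; exact: tail_small.
  by have [r [? [? ?]]] := filter_ex (filterI h1 (filterI h2 h3)); exists r.
have [del del0 hdel] := class_C_uniform cf eps0.
pose rho s : R := 1 + kap * (r <= s)%R%:R.
have rho1 s : 1 <= rho s by rewrite lerDl mulr_ge0.
have rho0 s : 0 <= s -> 0 <= rho s by move=> _; exact: le_trans ler01 (rho1 s).
have wB (chi : R -> R) l u : sampling_kernel n chi -> (moment_tail n chi r < tau%:E)%E ->
    (l <= n)%N -> (lattice_sum chi (fun s => (s + 1) ^+ l * rho s)%R u <= (B chi l)%:E)%E.
  move=> K tr ln; apply: (lattice_sum_expr_add1_tail _ ln _ _ kap0 r1 (ltW tr) ktau).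
    exact: kernel_moment_fin.
  exact: (kernel_moment_fin K (leq0n n)).
near=> w => p.
have w0 : 0 < w by near: w; exact: nbhs_pinfty_gt.
have wr : (r + 1) / del < w by near: w; apply: nbhs_pinfty_gt; rewrite num_real.
have {}wr : r + 1 < w * del by rewrite ltr_pdivrMr in wr.
have H p' km q : in_cell w km q -> `|taylor_poly n f p' q - f p'| <=
     \sum_(l < n.+1) \sum_(j : {ffun 'I_d -> 'I_n.+1} | (l + \sum_i j i == n)%N)
       eps * (rho (gap0 w p' km) * \prod_i rho (gap w p' km i)) *
       `|taylor_monomial p' q l (fun i => j i)|.
  move=> qc; apply: (taylor_poly_error (Om := fun _ _ =>
    eps * (rho (gap0 w p' km) * \prod_i rho (gap w p' km i)))); first exact: cf.1.
  move=> l j lj z zb; have [b1 b2] := cell_box_gap w0 qc zb.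
  have P1 : 1 <= \prod_i rho (gap w p' km i) by exact: prodr_ge1.
  have crude : `|pderiv l j f z - pderiv l j f q| <= eps * (1 + kap).
    apply: le_trans (ler_normB _ _) _.
    apply: (@le_trans _ _ (C + C)); first by rewrite lerD ?hC.
    by rewrite mulrDr mulr1 /kap mulrCA divff ?gt_eqF// mulr1 lerDr ltW.
  have big x : r <= x -> rho x = 1 + kap by move=> rx; rewrite /rho rx mulr1.
  (* One large gap suffices to pay for the crude bound. *)
  have [g0|g0] := leP r (gap0 w p' km).
    apply: le_trans crude _; rewrite ler_pM2l// big// ler_peMr//.
    by rewrite addr_ge0.
  have [/existsP[i gi]|/existsPn gi] := boolP [exists i, r <= gap w p' km i].
    apply: le_trans crude _; rewrite ler_pM2l// (bigD1 i)//= (big _ gi) mulrCA.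
    rewrite ler_peMr ?addr_ge0//; apply: mulr_ege1 => //; exact: prodr_ge1.
  have lt_del (x y : R) : w * x <= y + 1 -> y < r -> x < del.
    by move=> xy yr; rewrite -(ltr_pM2l w0); apply: le_lt_trans wr; lra.
  apply: ltW; apply: (@lt_le_trans _ _ eps).
    apply: hdel => //; first exact: lt_del b1 g0.
    by move=> i; apply: lt_del (b2 i) _; rewrite ltNge.
  by rewrite ler_peMr ?(ltW eps0)// mulr_ege1.
have [_ /(_ p)] := kantorovich_estimate (om := fun _ _ => eps) (rho := rho) hphi hpsi w0
  (fun _ _ => ltW eps0) rho0 (class_C_continuous cf.1) H
  (fun l u ln => wB phi l u hphi rphi ln)
  (fun i l u ln => wB (psi i) l u (hpsi i) (rpsi i) ln).
move=> /le_trans; apply.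
apply: (@le_trans _ _ (eps * w ^- n * D)).
  rewrite le_eqVlt; apply/orP; left; apply/eqP.
  rewrite /D mulr_sumr; apply: eq_bigr => l _; rewrite mulr_sumr; apply: eq_bigr => j _.
  by ring.
rewrite mulrAC ler_wpM2r ?invr_ge0 ?exprn_ge0 ?(ltW w0)//.
by rewrite /eps mulrAC ler_pdivrMr// ler_pM2l// lerDl.
Unshelve. all: by end_near. Qed.

End Main.

Theorem theorem2 (R : realType) (d n : nat) (phi : R -> R)
    (psi : 'I_d -> R -> R) (hd : (1 <= d)%N)
    (hphi : sampling_kernel n phi) (hpsi : forall i, sampling_kernel n (psi i)) :
  let err (w : R) (f : R * 'rV[R]_d -> R) : \bar R :=
    supnorm (fun p => kantorovich n w phi psi f p - f p) in

  (forall f : R * 'rV[R]_d -> R, class_C n f ->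
     [/\ forall w : R, 0 < w -> kantorovich_converges n w phi psi f,
         \forall w \near +oo, err w f \is a fin_num
       & (fun w : R => fine (err w f)) =o_+oo (fun w : R => w ^- n)])
  /\

  (forall f : R * 'rV[R]_d -> R, class_C n f ->
     (moment phi n.+1%:R%R < +oo)%E ->
     (forall i, (moment (psi i) n.+1%:R%R < +oo)%E) ->
     forall w : R, 0 < w ->
     (err w f <=
       ((2 : R) ^ (n%:Z - d.+1%:Z) / w ^+ n)%:E *
       \sum_(l < n.+1)
         \sum_(j : {ffun 'I_d -> 'I_n.+1} | (l + \sum_i j i == n)%N)
           (((mfact R l (fun i => j i))^-1)%:E *
            modulus (pderiv l (fun i => j i) f) (w^-1)%R (fun=> (w^-1)%R) *
            (moment phi l.+1%:R%R + 2%:E * moment phi l%:R%R +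
             moment phi 1%R + 2%:E * moment phi 0%R) *
            \prod_(i < d)
              (moment (psi i) (j i).+1%:R%R + 2%:E * moment (psi i) (j i)%:R%R +
               moment (psi i) 1%R + 2%:E * moment (psi i) 0%R)))%E)
  /\

  (forall f : R * 'rV[R]_d -> R, class_Cb n.+1 f ->
     (moment phi n.+1%:R%R < +oo)%E ->
     (forall i, (moment (psi i) n.+1%:R%R < +oo)%E) ->
     forall w : R, 0 < w ->
     kantorovich_converges n w phi psi f /\
     (err w f <=
       ((2 : R) ^ (n%:Z - d%:Z) / w ^+ n.+1)%:E *
       \sum_(l < n.+2)
         \sum_(j : {ffun 'I_d -> 'I_n.+2} | (l + \sum_i j i == n.+1)%N)
           (((mfact R l (fun i => j i))^-1)%:E *
            supnorm (pderiv l (fun i => j i) f) *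
            (moment phi l%:R%R + moment phi 0%R) *
            \prod_(i < d) (moment (psi i) (j i)%:R%R + moment (psi i) 0%R)))%E).
Proof.
move=> err; split; [|split].
- move=> f cf; split.
  + by move=> w w0; exact: class_C_converges.
  + apply: filterS (class_C_small hphi hpsi cf ltr01) => w hw.
    exact: supnorm_fin hw.
  + apply/eqoP => e e0; near=> w.
    have w0 : 0 < w by near: w; exact: nbhs_pinfty_gt.
    have hw : forall p, `|kantorovich n w phi psi f p - f p| <= e * w ^- n.
      by near: w; exact: class_C_small.
    have wn0 : 0 <= w ^- n by rewrite invr_ge0 exprn_ge0// ltW.
    rewrite (ger0_norm wn0) ger0_norm; last exact/fine_ge0/supnorm_ge0.
    by rewrite -lee_fin fineK; [exact: supnorm_le|exact: supnorm_fin hw].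
- move=> f cf mphi mpsi w w0.
  have fphi k (kn : (k <= n.+1)%N) := moment_valueE (kernel_moment_fin_next hphi mphi kn).
  have fpsi i k (kn : (k <= n.+1)%N) := moment_valueE (kernel_moment_fin_next (hpsi i) (mpsi i) kn).
  have [C C0 hC] := class_C_bounded cf.
  have wV0 : 0 < w^-1 by rewrite invr_gt0.
  have est p := class_C_modulus_estimate hphi hpsi p cf mphi mpsi w0.
  rewrite /err; apply: le_trans (supnorm_le est) _.
  rewrite EFinM; rewrite le_eqVlt; apply/orP; left; apply/eqP; congr (_ * _)%E.
  rewrite -sumEFin; apply: eq_bigr => l _; rewrite -sumEFin; apply: eq_bigr => j /eqP lj.
  have ln : (l <= n)%N by rewrite -ltnS.
  rewrite !EFinM fineK ?(modulus_fin wV0 (hC l _ lj))//; congr (_ * _ * _ * _)%E.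
    rewrite (fphi _ (_ : (l.+1 <= n.+1)%N))// (fphi _ (leqW ln)).
    by rewrite (fphi 1%N)// (fphi 0%N)// !EFinD !EFinM.
  rewrite -prodEFin; apply: eq_bigr => i _.
  have jn : (j i <= n)%N by rewrite -ltnS.
  rewrite (fpsi i _ (_ : ((j i).+1 <= n.+1)%N))// (fpsi i _ (leqW jn)).
  by rewrite (fpsi i 1%N)// (fpsi i 0%N)// !EFinD !EFinM.
- move=> f cf mphi mpsi w w0.
  have fphi k (kn : (k <= n.+1)%N) := moment_valueE (kernel_moment_fin_next hphi mphi kn).
  have fpsi i k (kn : (k <= n.+1)%N) := moment_valueE (kernel_moment_fin_next (hpsi i) (mpsi i) kn).
  have [conv est] := class_Cb_estimate hphi hpsi cf mphi mpsi w0.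
  split=> //; rewrite /err; apply: le_trans (supnorm_le est) _.
  rewrite EFinM; rewrite le_eqVlt; apply/orP; left; apply/eqP; congr (_ * _)%E.
  rewrite -sumEFin; apply: eq_bigr => l _; rewrite -sumEFin; apply: eq_bigr => j /eqP lj.
  have [_ bf] := cf.2 l _ (eq_leq lj).
  have [C hC] := filter_ex (bounded_fun_le bf).
  rewrite !EFinM fineK ?(supnorm_fin hC)//; congr (_ * _ * _ * _)%E.
    by rewrite (fphi l) 1?(fphi 0%N) ?EFinD// -ltnS.
  rewrite -prodEFin; apply: eq_bigr => i _.
  by rewrite (fpsi i (j i)) 1?(fpsi i 0%N) ?EFinD// -ltnS.
Unshelve. all: by end_near. Qed.
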